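(* There exists an infinite dimensional chaotic Banach algebra.
   Context: A Banach algebra is a complex algebra $A$, possibly without unit, equipped with a complete norm satisfying $\|ab\|\le\|a\|\,\|b\|$. Let $A^{\#}=A\oplus\mathrm{span}\{\mathbf 1\}$ be the unitalization of $A$, with unit $\mathbf 1$. An element $a\in A$ is a supercyclic element of $A$ if $\{za^n: z\in\mathbb C,\ n\in\mathbb N\}$ is dense in $A$; it is an almost hypercyclic element if $\{(\mathbf 1+a)^n a: n\in\mathbb N\}$ is dense in $A$ (products computed in $A^{\#}$); it is a chaotic element if it is both supercyclic and almost hypercyclic. $A$ is called chaotic if it has a chaotic element. Here $\mathbb N$ is the set of positive integers. *)

(* Defs.v *)
From HB Require Import structures.
From mathcomp Require Import all_boot all_order all_algebra.
From mathcomp Require Import all_classical all_reals all_analysis.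
From mathcomp Require Import complex.
Set Implicit Arguments. Unset Strict Implicit. Unset Printing Implicit Defensive.
Import Order.TTheory GRing.Theory Num.Theory.
Import numFieldNormedType.Exports.
Local Open Scope classical_set_scope.
Local Open Scope ring_scope.

Definition is_banach_algebra (R : rcfType) (A : completeNormedModType R[i])
    (mul : A -> A -> A) : Prop :=
  associative mul /\
  (forall x y z, mul (x + y) z = mul x z + mul y z) /\
  (forall x y z, mul x (y + z) = mul x y + mul x z) /\
  (forall (c : R[i]) x y, mul (c *: x) y = c *: mul x y) /\
  (forall (c : R[i]) x y, mul x (c *: y) = c *: mul x y) /\
  (forall x y, `|mul x y| <= `|x| * `|y|).

(* a ^+ n.+1 computed with mul : [pow mul a n] = a^(n+1). *)
Definition pow_pos (R : rcfType) (A : completeNormedModType R[i])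
    (mul : A -> A -> A) (a : A) (n : nat) : A := iter n (mul a) a.

(* (1 + a)^n a computed in the unitalization A^# = A (+) C 1:
   left multiplication by (1 + a) maps x in A to x + a x. *)
Definition unit_orbit (R : rcfType) (A : completeNormedModType R[i])
    (mul : A -> A -> A) (a : A) (n : nat) : A :=
  iter n (fun x => x + mul a x) a.

(* a is supercyclic: {z a^n : z in C, n >= 1} is dense in A
   (pow_pos mul a n = a^(n+1), n ranging over all of nat). *)
Definition supercyclic (R : rcfType) (A : completeNormedModType R[i])
    (mul : A -> A -> A) (a : A) : Prop :=
  dense [set z *: pow_pos mul a n | z in [set: R[i]] & n in [set: nat]].

Definition almost_hypercyclic (R : rcfType) (A : completeNormedModType R[i])
    (mul : A -> A -> A) (a : A) : Prop :=
  dense [set unit_orbit mul a n | n in [set n : nat | (0 < n)%N]].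

Definition chaotic_element (R : rcfType) (A : completeNormedModType R[i])
    (mul : A -> A -> A) (a : A) : Prop :=
  supercyclic mul a /\ almost_hypercyclic mul a.

Definition infinite_dimensional (R : rcfType) (A : completeNormedModType R[i])
    : Prop :=
  forall n : nat, exists v : 'I_n -> A,
    forall c : 'I_n -> R[i], \sum_(i < n) c i *: v i = 0 -> forall i, c i = 0.

(* Main.v *)
Require Import Defs.
From HB Require Import structures.
From mathcomp Require Import all_boot all_order all_algebra.
From mathcomp Require Import all_classical all_reals all_analysis.
From mathcomp Require Import complex.
From mathcomp Require Import ring lra.
Import Order.TTheory GRing.Theory Num.Theory.
Import numFieldNormedType.Exports.
Local Open Scope ring_scope.

(* The algebra is a completion of X C[X] for the largest submultiplicative
   seminorm with |X| <= 1 and |h_k| <= eps_k, where h_k runs through relations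
   of the two shapes q - c X^N and X + c X^(e+1) - X (1 + X)^n. The relations of
   the first shape make X supercyclic; hence the elements X + c X^N are dense, so
   that the second shape suffices for the density of the orbit X (1 + X)^n.
   The seminorm is nonzero as soon as some linear functional phi on C[X] with
   phi(X) <> 0 is bounded by w on every product of X's and h_k's of weight w.
   Such a phi is a limit of functionals supported on finitely many degrees. To
   impose a new relation h on phi, supported in degrees < N, replace phi by
   u |-> phi (u mod D), where D is a divisor of h, of degree N, whose N roots are
   very small, and truncate in high degree: the values on the previous products
   barely change, while the products containing h become negligible.
   For h = q - c X^N with c large, D = X^N - q / c; for the second shape,
   D collects roots of h that lie close to the points w^j - 1, w = exp(2 i pi / n). *)

Set Implicit Arguments. Unset Strict Implicit. Unset Printing Implicit Defensive.

(** * Polynomials and linear functionals *)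

Section Cnorm.
Variable R : realType.
Notation C := R[i].
Implicit Types (z w : C) (x : R).

(** The norm of [R[i]] takes its values in [R[i]]; this version lives in [R], where [lra], [sup] and
    [inf] apply. *)
Definition cn z : R := Normc.normc z.
Arguments cn : simpl never.

Lemma normE z : `|z| = (cn z)%:C%C. Proof. by []. Qed.
Lemma cnM z w : cn (z * w) = cn z * cn w. Proof. exact: Normc.normcM. Qed.
Lemma cnV z : cn z^-1 = (cn z)^-1. Proof. exact: Normc.normcV. Qed.
Lemma cn0 : cn 0 = 0. Proof. exact: Normc.normc0. Qed.
Lemma cn1 : cn 1 = 1. Proof. exact: Normc.normc1. Qed.
Lemma cnD z w : cn (z + w) <= cn z + cn w. Proof. exact: le_normcD. Qed.
Lemma cnN z : cn (- z) = cn z. Proof. exact: normcN. Qed.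
Lemma cnB z w : cn (z - w) = cn (w - z). Proof. by rewrite -cnN opprB. Qed.
Lemma cn_ge0 z : 0 <= cn z.
Proof. by case: z => a b; rewrite /cn /= sqrtr_ge0. Qed.
Lemma cn_eq0 z : (cn z == 0) = (z == 0).
Proof. by apply/eqP/eqP => [/Normc.eq0_normc//|->]; rewrite cn0. Qed.
Lemma cn_gt0 z : (0 < cn z) = (z != 0).
Proof. by rewrite lt_def cn_ge0 andbT cn_eq0. Qed.
Lemma cnX z n : cn (z ^+ n) = cn z ^+ n.
Proof. by elim: n => [|n IH]; rewrite ?expr0 ?cn1// !exprS cnM IH. Qed.
Lemma cn_real x : cn x%:C%C = `|x|.
Proof. by rewrite /cn /= expr0n addr0 sqrtr_sqr. Qed.
Lemma cn_nat n : cn n%:R = n%:R.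
Proof.
have -> : (n%:R : C) = (n%:R)%:C%C by rewrite rmorph_nat.
by rewrite cn_real ger0_norm.
Qed.
Lemma cn_sum (I : Type) (s : seq I) (P : pred I) (F : I -> C) :
  cn (\sum_(i <- s | P i) F i) <= \sum_(i <- s | P i) cn (F i).
Proof.
elim/big_rec2: _ => [|i x y _ h]; first by rewrite cn0.
by apply: le_trans (cnD _ _) _; rewrite lerD2l.
Qed.
Lemma cn_trans u z w : cn (z - w) <= cn (z - u) + cn (u - w).
Proof. by apply: le_trans _ (cnD _ _); rewrite addrA subrK. Qed.

Lemma Re_le_cn z : `|complex.Re z| <= cn z.
Proof.
case: z => a b; rewrite /cn /= -sqrtr_sqr ler_wsqrtr// lerDl; exact: sqr_ge0.
Qed.
Lemma Im_le_cn z : `|complex.Im z| <= cn z.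
Proof.
case: z => a b; rewrite /cn /= -sqrtr_sqr ler_wsqrtr// lerDr; exact: sqr_ge0.
Qed.
Lemma cn_le_ReIm z : cn z <= `|complex.Re z| + `|complex.Im z|.
Proof.
case: z => a b /=; have -> : (a +i* b)%C = a%:C%C + 'i%C * b%:C%C.
  by rewrite [LHS]complexE.
apply: le_trans (cnD _ _) _; rewrite cnM !cn_real.
have -> : cn 'i%C = 1 by rewrite /cn /= expr0n expr1n add0r sqrtr1.
by rewrite mul1r.
Qed.

(** The intervals [x k - a k, x k + a k] meet pairwise, so the supremum of their left ends lies in
    all of them. *)
Lemma real_limit (a x : nat -> R) :
  (forall k l, `|x k - x l| <= a k + a l) ->
  exists L, forall k, `|L - x k| <= a k.
Proof.
move=> h; pose S := [set x k - a k | k in setT]%classic.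
have ub l : ubound S (x l + a l).
  move=> _ [k _ <-]; have := h k l; rewrite ler_norml => /andP[_]; lra.
exists (sup S) => k; rewrite ler_norml; apply/andP; split.
  have : x k - a k <= sup S; last lra.
  by apply: ub_le_sup; [exists (x 0%N + a 0%N); exact: ub|exists k].
have : sup S <= x k + a k; last lra.
by apply: ge_sup; [exists (x 0%N - a 0%N); exists 0%N|exact: ub].
Qed.

(** Real and imaginary parts are treated separately, whence the factor 2. *)
Lemma complex_limit (a : nat -> R) (x : nat -> C) :
  (forall k l, cn (x k - x l) <= a k + a l) ->
  exists L, forall k, cn (L - x k) <= a k *+ 2.
Proof.
move=> h.
have [k l|A hA] := @real_limit a (fun k => complex.Re (x k)).
  apply: le_trans (h k l); apply: le_trans (Re_le_cn _).
  by case: (x k) => ? ?; case: (x l).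
have [k l|B hB] := @real_limit a (fun k => complex.Im (x k)).
  apply: le_trans (h k l); apply: le_trans (Im_le_cn _).
  by case: (x k) => ? ?; case: (x l).
exists (A +i* B)%C => k; apply: le_trans (cn_le_ReIm _) _.
by move: (hA k) (hB k); case: (x k) => u v /=; rewrite mulr2n; exact: lerD.
Qed.

End Cnorm.

Arguments cn {R} z : simpl never.

(** * Linear functionals on C[X] as sequences, and the action of C[X] on them *)

Section Functionals.
Variable R : realType.
Notation C := R[i].
Implicit Types (f g : nat -> C) (u v : {poly C}).

(* A sequence f stands for the linear functional X^i |-> f i on C[X]. *)
Definition ev f u : C := \sum_(i < size u) u`_i * f i.

Lemma ev_wide n f u : (size u <= n)%N -> ev f u = \sum_(i < n) u`_i * f i.
Proof.
move=> h; rewrite /ev (big_ord_widen n (fun i => u`_i * f i) h) big_mkcond.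
apply: eq_bigr => i _; case: ifPn => //; rewrite -leqNgt => h'.
by rewrite nth_default ?mul0r.
Qed.

Lemma evD f u v : ev f (u + v) = ev f u + ev f v.
Proof.
pose n := maxn (size u) (size v).
rewrite !(@ev_wide n) ?leq_maxl ?leq_maxr//; last exact: size_polyD.
by rewrite -big_split; apply: eq_bigr => i _; rewrite coefD mulrDl.
Qed.

Lemma evZ f c u : ev f (c *: u) = c * ev f u.
Proof.
rewrite (@ev_wide (size u)) ?size_scale_leq// /ev mulr_sumr.
by apply: eq_bigr => i _; rewrite coefZ mulrA.
Qed.

Lemma ev0 f : ev f 0 = 0.
Proof. by rewrite /ev size_poly0 big_ord0. Qed.

Lemma ev_sum f (I : Type) (s : seq I) (P : pred I) (F : I -> {poly C}) :
  ev f (\sum_(i <- s | P i) F i) = \sum_(i <- s | P i) ev f (F i).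
Proof. exact: (big_morph (ev f) (evD f) (ev0 f)). Qed.

Lemma evXn f i : ev f 'X^i = f i.
Proof.
rewrite /ev size_polyXn big_ord_recr /= big1 ?add0r ?coefXn ?eqxx ?mul1r//.
by move=> j _; rewrite coefXn ltn_eqF ?mul0r.
Qed.

Lemma evDl f g u : ev (f + g) u = ev f u + ev g u.
Proof. by rewrite /ev -big_split; apply: eq_bigr => i _; rewrite mulrDr. Qed.

Lemma evNl f u : ev (- f) u = - ev f u.
Proof. by rewrite /ev -sumrN; apply: eq_bigr => i _; rewrite mulrN. Qed.

Lemma evZl c f u : ev (fun i => c * f i) u = c * ev f u.
Proof. by rewrite /ev mulr_sumr; apply: eq_bigr => i _; rewrite mulrCA. Qed.

(** The transpose of multiplication by [u]; it turns the functionals into a C[X]-module. *)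
Definition act u f : nat -> C := fun i => ev f (u * 'X^i).

Lemma ev_act f u v : ev (act u f) v = ev f (u * v).
Proof.
rewrite {2}(_ : v = \sum_(i < size v) v`_i *: 'X^i); last first.
  by rewrite -[LHS]coefK poly_def.
rewrite mulr_sumr ev_sum; apply: eq_bigr => i _.
by rewrite -scalerAr evZ.
Qed.

Lemma ev_inj f g : (forall u, ev f u = ev g u) -> f = g.
Proof. by move=> h; apply/funext => i; rewrite -!evXn h. Qed.

Lemma actM u v f : act u (act v f) = act (u * v) f.
Proof. by apply: ev_inj => w; rewrite !ev_act; congr ev; ring. Qed.

Lemma actDl u v f : act (u + v) f = act u f + act v f.
Proof. by apply/funext => i; rewrite /act mulrDl evD. Qed.

Lemma actD u f g : act u (f + g) = act u f + act u g.
Proof. by apply/funext => i; rewrite /act evDl. Qed.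

Lemma actB u f g : act u (f - g) = act u f - act u g.
Proof. by rewrite actD; congr (_ + _); apply/funext => i; rewrite /act evNl. Qed.

Lemma actZl c u f : act (c *: u) f = fun i => c * act u f i.
Proof. by apply/funext => i; rewrite /act -scalerAl evZ. Qed.

Lemma actZ c u f : act u (fun i => c * f i) = fun i => c * act u f i.
Proof. by apply/funext => i; rewrite /act evZl. Qed.

Lemma act1 f : act 1 f = f.
Proof. by apply: ev_inj => u; rewrite ev_act mul1r. Qed.

Lemma actC c f : act c%:P f = fun i => c * f i.
Proof. by rewrite -[c%:P]mulr1 mul_polyC actZl act1. Qed.

Lemma act0 u : act u 0 = 0.
Proof. by apply/funext => i; rewrite /act /ev big1// => j _; rewrite mulr0. Qed.

Lemma act0l f : act 0 f = 0.
Proof. by apply/funext => i; rewrite /act mul0r ev0. Qed.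

End Functionals.

(** * The Banach algebra defined by a set of relations *)

Section OperatorAlgebra.
Variable R : realType.
Notation C := R[i].
Variable H : {poly C} -> R -> Prop.
Implicit Types (f g : nat -> C) (u v : {poly C}) (t s e : R).

(* [H h e] imposes |h| <= e; [mon u w] says that u is a product of X's and of
   such h's whose weight is w, X having weight 1. *)
Inductive mon : {poly C} -> R -> Prop :=
| mon1 : mon 1 1
| monX u w : mon u w -> mon ('X * u) w
| monH h e u w : H h e -> 0 <= e -> mon u w -> mon (h * u) (e * w).

Lemma mon_ge0 u w : mon u w -> 0 <= w.
Proof. by elim => // *; rewrite mulr_ge0. Qed.

Lemma monXn i : mon 'X^i 1.
Proof. by elim: i => [|i IH]; rewrite ?expr0 ?exprS; constructor. Qed.

(* The ball of radius t in the dual of the seminorm. *)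
Definition Psi t f := forall u w, mon u w -> cn (ev f u) <= t * w.

Lemma PsiD t s f g : Psi t f -> Psi s g -> Psi (t + s) (f + g).
Proof.
move=> hf hg u w m; rewrite evDl mulrDl; apply: le_trans (cnD _ _) _.
by rewrite lerD ?hf ?hg.
Qed.
Lemma PsiN t f : Psi t f -> Psi t (- f).
Proof. by move=> hf u w m; rewrite evNl cnN; exact: hf. Qed.
Lemma PsiB t s f g : Psi t f -> Psi s g -> Psi (t + s) (f - g).
Proof. by move=> hf hg; apply: PsiD hf (PsiN hg). Qed.
Lemma PsiZ t c f : Psi t f -> Psi (cn c * t) (fun i => c * f i).
Proof.
by move=> hf u w m; rewrite evZl cnM -mulrA ler_wpM2l ?cn_ge0 ?hf.
Qed.
Lemma Psi0 t : 0 <= t -> Psi t 0.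
Proof.
move=> t0 u w m; rewrite /ev big1 ?cn0 ?mulr_ge0 ?(mon_ge0 m)// => i _.
by rewrite mulr0.
Qed.
Lemma Psi_le t s f : t <= s -> Psi t f -> Psi s f.
Proof.
by move=> ts hf u w m; apply: le_trans (hf _ _ m) _; rewrite ler_wpM2r ?(mon_ge0 m).
Qed.
Lemma Psi_eps t f : (forall e, 0 < e -> Psi (t + e) f) -> Psi t f.
Proof.
move=> h u w m; apply/ler_addgt0Pr => e e0.
have w0 := mon_ge0 m.
have d0 : 0 < e / (w + 1) by rewrite divr_gt0 ?ltr_wpDl.
apply: le_trans (h _ d0 _ _ m) _; rewrite mulrDl lerD2l.
rewrite mulrAC ler_pdivrMr ?ltr_wpDl// ler_pM2l//; lra.
Qed.
Lemma Psi_eq0 f : Psi 0 f -> f = 0.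
Proof.
move=> h; apply/funext => i; apply/eqP; rewrite -cn_eq0 eq_le cn_ge0 andbT.
by have := h _ _ (monXn i); rewrite evXn mul0r.
Qed.
Lemma Psi_eps0 f t : (forall e, 0 < e -> Psi (e * t) f) -> 0 <= t -> f = 0.
Proof.
move=> h t0; apply: Psi_eq0; apply: Psi_eps => e e0; rewrite add0r.
have p : 0 < t + 1 by rewrite ltr_wpDl.
apply: Psi_le (h (e / (t + 1)) (divr_gt0 e0 p)).
rewrite mulrAC ler_pdivrMr// ler_pM2l//; lra.
Qed.
(** A polynomial involves finitely many coordinates, so coordinatewise convergence suffices; the
    threshold may depend on the product [u]. *)
Lemma Psi_lim (F : nat -> nat -> C) (a : nat -> R) t f :
  (forall k i, cn (f i - F k i) <= a k) ->
  (forall e, 0 < e -> exists k0, forall k, (k0 <= k)%N -> a k <= e) ->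
  (forall u w, mon u w -> exists k0, forall k, (k0 <= k)%N ->
     cn (ev (F k) u) <= t * w) -> Psi t f.
Proof.
move=> h1 h2 h3 u w m; apply/ler_addgt0Pr => e e0.
pose A := \sum_(i < size u) cn u`_i.
have A0 : 0 <= A by apply: sumr_ge0 => i _; exact: cn_ge0.
have [k0 hk0] := h2 (e / (A + 1)) (divr_gt0 e0 (ltr_wpDl A0 ltr01)).
have [k1 hk1] := h3 _ _ m.
pose k := maxn k0 k1.
have -> : ev f u = ev (F k) u + ev (f - F k) u by rewrite evDl evNl addrCA subrr addr0.
apply: le_trans (cnD _ _) _; apply: lerD; first by apply: hk1; rewrite leq_maxr.
apply: le_trans (cn_sum _ _ _) _.
have -> : e = (A + 1) * (e / (A + 1)) by rewrite mulrC mulfVK// gt_eqF// ltr_wpDl.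
apply: le_trans (_ : A * (e / (A + 1)) <= _); last first.
  by rewrite ler_wpM2r ?divr_ge0 ?addr_ge0 ?(ltW e0)// lerDl.
rewrite mulr_suml; apply: ler_sum => i _; rewrite cnM ler_wpM2l ?cn_ge0//.
by apply: le_trans (h1 _ _) _; apply: hk0; rewrite leq_maxl.
Qed.

Definition dualb f := exists2 t : R, 0 <= t & Psi t f.

Lemma Psi_act_H h e t f : H h e -> 0 <= e -> Psi t f -> Psi (e * t) (act h f).
Proof.
move=> hh e0 hf u w m; rewrite ev_act (mulrC e) -mulrA.
exact: hf (monH hh e0 m).
Qed.
Lemma Psi_act_X t f : Psi t f -> Psi t (act 'X f).
Proof. by move=> hf u w m; rewrite ev_act; apply: hf; constructor. Qed.
(** The l1 norm of the coefficients. It dominates the seminorm, because every power of X has weight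
    1. *)
Definition wt u : R := \sum_(i < size u) cn u`_i.
Lemma wt_ge0 u : 0 <= wt u.
Proof. by apply: sumr_ge0 => i _; exact: cn_ge0. Qed.
Lemma Psi_act_Xn t f i : Psi t f -> Psi t (act 'X^i f).
Proof.
move=> hf; elim: i => [|i IH]; last by rewrite exprS -actM; exact: Psi_act_X.
by rewrite expr0 act1.
Qed.
Lemma Psi_act u t f : 0 <= t -> Psi t f -> Psi (wt u * t) (act u f).
Proof.
move=> t0 hf v w m; rewrite ev_act.
rewrite {1}(_ : u = \sum_(i < size u) u`_i *: 'X^i); last first.
  by rewrite -[LHS]coefK poly_def.
rewrite mulr_suml ev_sum; apply: le_trans (cn_sum _ _ _) _.
rewrite /wt -mulrA mulr_suml; apply: ler_sum => i _.
rewrite -scalerAl evZ cnM -ev_act ler_wpM2l ?cn_ge0//.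
exact: (Psi_act_Xn _ hf).
Qed.

Lemma dualbD f g : dualb f -> dualb g -> dualb (f + g).
Proof.
move=> [t t0 hf] [s s0 hg]; exists (t + s); first exact: addr_ge0.
exact: PsiD.
Qed.
Lemma dualbZ c f : dualb f -> dualb (fun i => c * f i).
Proof.
move=> [t t0 hf]; exists (cn c * t); first by rewrite mulr_ge0 ?cn_ge0.
exact: PsiZ.
Qed.
Lemma dualb_act u f : dualb f -> dualb (act u f).
Proof.
move=> [t t0 hf]; exists (wt u * t); first by rewrite mulr_ge0 ?wt_ge0.
exact: Psi_act.
Qed.
Lemma dualb0 : dualb 0. Proof. by exists 0 => //; exact: Psi0. Qed.

Notation op := ((nat -> C) -> (nat -> C)).
Implicit Types T S : op.

Lemma op_subE T S f : (T - S) f = T f - S f. Proof. by []. Qed.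

(** The operator norm of [T] on the dual space is at most [e]. *)
Definition bnd e T := forall t f, 0 <= t -> Psi t f -> Psi (e * t) (T f).

(* The algebra acts on the dual space [dualb]; its elements are extended by 0
   outside, so that equal operators are equal as functions. *)
Definition opa u : op := fun f => if `[< dualb f >] then act u f else 0.

Lemma opaE u f : dualb f -> opa u f = act u f.
Proof. by move=> h; rewrite /opa asboolT. Qed.
Lemma opaF u f : ~ dualb f -> opa u f = 0.
Proof. by move=> h; rewrite /opa asboolF. Qed.

Lemma opaM u v : opa (u * v) = opa u \o opa v.
Proof.
apply/funext => f /=; have [d|nd] := pselect (dualb f).
  by rewrite !opaE ?actM//; exact: dualb_act.
by rewrite !(opaF _ nd) opaE ?act0//; exact: dualb0.
Qed.
Lemma opaD u v : opa (u + v) = opa u + opa v.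
Proof.
apply/funext => f; rewrite fctE; have [d|nd] := pselect (dualb f).
  by rewrite !opaE ?actDl.
by rewrite !(opaF _ nd) addr0.
Qed.
Lemma opaZ c u : opa (c *: u) = fun f i => c * opa u f i.
Proof.
apply/funext => f; have [d|nd] := pselect (dualb f).
  by rewrite !opaE ?actZl.
by rewrite !(opaF _ nd); apply/funext => i /=; rewrite mulr0.
Qed.
Lemma opa0 : opa 0 = 0.
Proof.
apply/funext => f; rewrite /opa; case: ifP => // _; exact: act0l.
Qed.

Lemma Psi_dualb t f : 0 <= t -> Psi t f -> dualb f.
Proof. by exists t. Qed.

Lemma bnd_opa u : bnd (wt u) (opa u).
Proof.
by move=> t f t0 hf; rewrite opaE; [exact: Psi_act|exact: Psi_dualb hf].
Qed.
Lemma bnd_opa_H h e : H h e -> 0 <= e -> bnd e (opa h).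
Proof.
by move=> hh e0 t f t0 hf; rewrite opaE; [exact: Psi_act_H|exact: Psi_dualb hf].
Qed.

Lemma bndD c d T S : bnd c T -> bnd d S -> bnd (c + d) (T + S).
Proof.
move=> hT hS t f t0 hf; rewrite mulrDl.
by apply: PsiD; [exact: hT|exact: hS].
Qed.
Lemma bndZ c a T : bnd c T -> bnd (cn a * c) (fun f i => a * T f i).
Proof. by move=> hT t f t0 hf; rewrite -mulrA; apply: PsiZ; exact: hT. Qed.
Lemma bnd_comp c d T S : 0 <= d -> bnd c T -> bnd d S -> bnd (c * d) (T \o S).
Proof.
move=> d0 hT hS t f t0 hf; rewrite -mulrA; apply: hT; first exact: mulr_ge0.
exact: hS.
Qed.
Lemma bnd_le c d T : c <= d -> bnd c T -> bnd d T.
Proof.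
by move=> cd hT t f t0 hf; apply: Psi_le (hT _ _ t0 hf); rewrite ler_wpM2r.
Qed.
Lemma bnd_sub c d T S U : bnd c (T - S) -> bnd d (S - U) -> bnd (c + d) (T - U).
Proof. by move=> h1 h2; rewrite -[T](subrK S) -addrA; exact: bndD. Qed.
Lemma bnd_dualb c T f : 0 <= c -> bnd c T -> dualb f -> dualb (T f).
Proof. by move=> c0 hT [t t0 hf]; exists (c * t); [exact: mulr_ge0|exact: hT]. Qed.

(** The operator-norm closure of the multiplications by elements of X C[X]. Linearity is not
    demanded: it passes to the limit, by [inA_linear]. *)
Definition inA T := (forall f, ~ dualb f -> T f = 0) /\
  forall e, 0 < e -> exists v, bnd e (T - opa ('X * v)).

Lemma inA_bnd T : inA T -> exists2 c : R, 0 <= c & bnd c T.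
Proof.
move=> [_ /(_ 1 ltr01) [v hv]]; exists (1 + wt ('X * v)).
  by rewrite addr_ge0 ?wt_ge0.
by rewrite -[T](subrK (opa ('X * v))); apply: bndD hv (bnd_opa _).
Qed.

Lemma inA_dualb T f : inA T -> dualb f -> dualb (T f).
Proof. by move=> /inA_bnd [c c0 hc]; exact: bnd_dualb hc. Qed.

(** The defect of linearity of [T] equals that of [T - opa ('X * v)], as [opa] is linear on the
    dual; the latter operator can be made arbitrarily small. *)
Lemma inA_linear T a f g : inA T -> dualb f -> dualb g ->
  T (fun i => a * f i + g i) = fun i => a * T f i + T g i.
Proof.
move=> [_ hT] df dg.
have [t t0 hf] := df; have [s s0 hg] := dg.
set k := (fun i => _); set l := (fun i => _).
have k_E : k = (fun i => a * f i) + g by [].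
have dk : dualb k by rewrite k_E; apply: dualbD => //; exact: dualbZ.
pose B := cn a * t + s.
have B0 : 0 <= B by rewrite addr_ge0 ?mulr_ge0 ?cn_ge0.
have hk : Psi B k by rewrite k_E; apply: PsiD => //; exact: PsiZ.
suff : T k - l = 0 by move/eqP; rewrite subr_eq0 => /eqP.
apply: (@Psi_eps0 _ (B + B)); last exact: addr_ge0.
move=> e /hT [v hv]; set D := T - _ in hv.
have -> : T k - l = D k - ((fun i => a * D f i) + D g).
  rewrite /D !fctE !opaE// k_E actD actZ; apply/funext => i.
  rewrite /l !fctE; ring.
rewrite mulrDr; apply: PsiB; first exact: hv.
rewrite /B mulrDr; apply: PsiD; last exact: hv.
rewrite mulrCA; apply: PsiZ; exact: hv.
Qed.

Lemma inA0 T : inA T -> T 0 = 0.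
Proof.
move=> [_ hT]; apply: (@Psi_eps0 _ 1) => // e /hT [v hv].
have := hv 1 0 ler01 (Psi0 ler01); rewrite op_subE opaE ?act0 ?subr0//.
exact: dualb0.
Qed.

Lemma inA_opa v : inA (opa ('X * v)).
Proof.
split=> [f nd|e e0]; first exact: opaF.
exists v => t f t0 hf; rewrite subrr; apply: Psi0.
by rewrite mulr_ge0// ltW.
Qed.

Lemma inA_zmod a T S : inA T -> inA S -> inA ((fun f i => a * T f i) + S).
Proof.
move=> [hT0 hT] [hS0 hS]; split=> [f nd|e e0].
  by rewrite fctE hS0// hT0// addr0; apply/funext => i; rewrite mulr0.
have a0 : 0 < cn a + 1 by rewrite ltr_wpDl ?cn_ge0.
have d0 : 0 < e / 2 by rewrite divr_gt0.
have [v hv] := hT _ (divr_gt0 d0 a0).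
have [w hw] := hS _ d0.
exists (a *: v + w); rewrite mulrDr opaD -scalerAr opaZ opprD addrACA.
have -> : e = e / 2 + e / 2 by lra.
apply: bndD => //; apply: bnd_le (_ : bnd _ _); last first.
  move=> t f t0 hf; have -> : ((fun f i => a * T f i) - (fun f i => a * opa ('X * v) f i)) f
    = fun i => a * (T - opa ('X * v)) f i.
    by apply/funext => i; rewrite !fctE mulrBr.
  exact: (bndZ a hv).
by rewrite mulrCA ler_piMr ?(ltW d0)// ler_pdivrMr ?mul1r; lra.
Qed.

End OperatorAlgebra.

(** * Products in the closure, and the operator norm *)

Section OperatorNorm.
Variable R : realType.
Notation C := R[i].
Variable H : {poly C} -> R -> Prop.
Notation op := ((nat -> C) -> (nat -> C)).
Implicit Types (f g : nat -> C) (u v : {poly C}) (t s e : R) (T S : op).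

(** With U and V the approximations of T and S, T S - U V = T (S - V) + (T - U) V. Here V is chosen
    first, since the accuracy required of U depends on the size of V. *)
Lemma inA_comp T S : inA H T -> inA H S -> inA H (T \o S).
Proof.
move=> iT iS; split=> [f nd /=|e e0]; first by rewrite (iS.1 f nd) (inA0 iT).
have [c c0 hc] := inA_bnd iT.
have d0 : 0 < e / 2 by rewrite divr_gt0.
have c1 : 0 < c + 1 by rewrite ltr_wpDl.
have [v hv] := iS.2 _ (divr_gt0 d0 c1).
have w1 : 0 < wt ('X * v) + 1 by rewrite ltr_wpDl ?wt_ge0.
have [u hu] := iT.2 _ (divr_gt0 d0 w1).
exists (u * ('X * v)); rewrite mulrA opaM => t f t0 hf.
have df : dualb H f by exists t.
have dv : dualb H (opa H ('X * v) f) by rewrite opaE//; exact: dualb_act.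
have dS : dualb H (S f) by exact: inA_dualb.
have -> : (T \o S - (opa H ('X * u) \o opa H ('X * v))) f =
   T ((S - opa H ('X * v)) f) + (T - opa H ('X * u)) (opa H ('X * v) f).
  rewrite !op_subE /=.
  have -> : S f - opa H ('X * v) f = fun i => -1 * opa H ('X * v) f i + S f i.
    by apply/funext => i; rewrite mulN1r addrC.
  rewrite (inA_linear _ iT)//; apply/funext => i; rewrite !fctE.
  by rewrite mulN1r [- _ + _]addrC addrA subrK.
(* The last summand is nonnegative slack, due to the denominators c + 1 and wt + 1, which avoid
   division by zero. *)
have -> : e * t = c * (e / 2 / (c + 1) * t) + e / 2 / (wt ('X * v) + 1) * (wt ('X * v) * t)
   + ((1 - c / (c + 1)) + (1 - wt ('X * v) / (wt ('X * v) + 1))) * (e / 2 * t).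
  field; rewrite !gt_eqF//=.
apply: (@Psi_le _ _ (c * (e / 2 / (c + 1) * t) + e / 2 / (wt ('X * v) + 1) * (wt ('X * v) * t))).
  rewrite lerDl mulr_ge0 ?mulr_ge0 ?(ltW d0)//.
    by rewrite addr_ge0// subr_ge0 ler_pdivrMr// mul1r lerDl.
  exact: ltW.
apply: PsiD.
  by apply: hc; [rewrite mulr_ge0// ltW// divr_gt0|exact: hv].
by apply: hu; [rewrite mulr_ge0// wt_ge0|exact: bnd_opa].
Qed.

Definition opn T : R := inf [set c | 0 <= c /\ bnd H c T]%classic.

Lemma opn_le c T : 0 <= c -> bnd H c T -> opn T <= c.
Proof. by move=> c0 hT; apply: ge_inf; [exists 0 => x []|split]. Qed.

Lemma opn_ge0 T : inA H T -> 0 <= opn T.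
Proof.
by move=> /inA_bnd [c c0 hc]; apply: lb_le_inf; [exists c|move=> x []].
Qed.

Lemma bnd_opn T : inA H T -> bnd H (opn T) T.
Proof.
move=> iT t f t0 hf; apply: Psi_eps => e e0.
have t1 : 0 < t + 1 by rewrite ltr_wpDl.
have hi : has_inf [set c | 0 <= c /\ bnd H c T]%classic.
  by have [c c0 hc] := inA_bnd iT; split; [exists c|exists 0 => x []].
have [c [c0 hc] hlt] := inf_adherent (divr_gt0 e0 t1) hi.
apply: Psi_le (hc _ _ t0 hf); apply: le_trans (_ : (opn T + e / (t + 1)) * t <= _).
  by rewrite ler_wpM2r// ltW.
by rewrite mulrDl lerD2l mulrAC ler_pdivrMr// ler_pM2l//; lra.
Qed.

Lemma opn_eq0 T : inA H T -> opn T = 0 -> T = 0.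
Proof.
move=> iT h; apply/funext => f; have [[t t0 hf]|nd] := pselect (dualb H f).
  by apply: (@Psi_eq0 _ H); have := bnd_opn iT t0 hf; rewrite h mul0r.
by rewrite (iT.1 _ nd).
Qed.

End OperatorNorm.

(** * The algebra as a normed vector space over C *)

Section AlgebraType.
Variable R : realType.
Notation C := R[i].
Variable H : {poly C} -> R -> Prop.
Notation op := ((nat -> C) -> (nat -> C)).

Record alg := Alg { opval : op; opvalP : inA H opval }.
Implicit Types (x y z : alg) (a : C).

Lemma alg_inj x y : opval x = opval y -> x = y.
Proof.
case: x y => [T iT] [S iS] /= e; subst S; congr Alg; exact: Prop_irrelevance.
Qed.

HB.instance Definition _ := gen_eqMixin alg.
HB.instance Definition _ := gen_choiceMixin alg.

Lemma opval_addP x y : inA H (opval x + opval y).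
Proof.
have := inA_zmod 1 (opvalP x) (opvalP y); congr inA.
by apply/funext => f; apply/funext => i; rewrite !fctE mul1r.
Qed.
Lemma opval_scaleP a x : inA H (fun f i => a * opval x f i).
Proof.
have i0 : inA H (0 : op) by have := inA_opa H 0; rewrite mulr0 opa0.
have := inA_zmod a (opvalP x) i0; congr inA.
by apply/funext => f; apply/funext => i; rewrite !fctE addr0.
Qed.
Lemma opval_oppP x : inA H (- opval x).
Proof.
have := opval_scaleP (-1) x; congr inA.
by apply/funext => f; apply/funext => i; rewrite !fctE mulN1r.
Qed.
Lemma opval_zeroP : inA H (0 : op).
Proof. by have := inA_opa H 0; rewrite mulr0 opa0. Qed.

Definition alg_add x y := Alg (opval_addP x y).
Definition alg_opp x := Alg (opval_oppP x).
Definition alg_zero := Alg opval_zeroP.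
Definition alg_scale a x := Alg (opval_scaleP a x).
Definition alg_mul x y := Alg (inA_comp (opvalP x) (opvalP y)).
(* The image of X * u, so that [alg_poly 1] is the generator X. *)
Definition alg_poly u := Alg (inA_opa H u).

Lemma alg_addA : associative alg_add.
Proof. by move=> x y z; apply: alg_inj; exact: addrA. Qed.
Lemma alg_addC : commutative alg_add.
Proof. by move=> x y; apply: alg_inj; exact: addrC. Qed.
Lemma alg_add0 : left_id alg_zero alg_add.
Proof. by move=> x; apply: alg_inj; exact: add0r. Qed.
Lemma alg_addN : left_inverse alg_zero alg_opp alg_add.
Proof. by move=> x; apply: alg_inj; exact: addNr. Qed.

HB.instance Definition _ :=
  GRing.isZmodule.Build alg alg_addA alg_addC alg_add0 alg_addN.

Lemma alg_scaleA a b x : alg_scale a (alg_scale b x) = alg_scale (a * b) x.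
Proof. by apply: alg_inj; do 2!apply/funext => ?; rewrite /= mulrA. Qed.
Lemma alg_scale1 : left_id 1 alg_scale.
Proof. by move=> x; apply: alg_inj; do 2!apply/funext => ?; rewrite /= mul1r. Qed.
Lemma alg_scaleDr : right_distributive alg_scale +%R.
Proof. by move=> a x y; apply: alg_inj; do 2!apply/funext => ?; exact: mulrDr. Qed.
Lemma alg_scaleDl x : {morph alg_scale^~ x : a b / a + b}.
Proof. by move=> a b; apply: alg_inj; do 2!apply/funext => ?; exact: mulrDl. Qed.

HB.instance Definition _ := GRing.Zmodule_isLmodule.Build C alg
  alg_scaleA alg_scale1 alg_scaleDr alg_scaleDl.

Definition nrm x : R := opn H (opval x).

Lemma nrm_le c x : 0 <= c -> bnd H c (opval x) -> nrm x <= c.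
Proof. exact: opn_le. Qed.
Lemma nrm_ge0 x : 0 <= nrm x. Proof. exact: opn_ge0 (opvalP x). Qed.
Lemma bnd_nrm x : bnd H (nrm x) (opval x). Proof. exact: bnd_opn (opvalP x). Qed.

Lemma nrmD x y : nrm (x + y) <= nrm x + nrm y.
Proof.
apply: nrm_le; first by rewrite addr_ge0 ?nrm_ge0.
by apply: bndD; exact: bnd_nrm.
Qed.
Lemma nrmZ_le a x : nrm (a *: x) <= cn a * nrm x.
Proof.
apply: nrm_le; first by rewrite mulr_ge0 ?nrm_ge0 ?cn_ge0.
by apply: bndZ; exact: bnd_nrm.
Qed.
Lemma nrm_eq0 x : nrm x = 0 -> x = 0.
Proof. by move=> h; apply: alg_inj; exact: (opn_eq0 (opvalP x) h). Qed.
Lemma nrmZ a x : nrm (a *: x) = cn a * nrm x.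
Proof.
have [->|a0] := eqVneq a 0.
  rewrite cn0 mul0r; apply/eqP; rewrite eq_le nrm_ge0 andbT.
  by apply: le_trans (nrmZ_le _ _) _; rewrite cn0 mul0r.
apply/eqP; rewrite eq_le nrmZ_le /=.
have -> : nrm x = nrm (a^-1 *: (a *: x)) by rewrite scalerA mulVf// scale1r.
rewrite mulrC -ler_pdivlMr ?cn_gt0// mulrC -cnV; exact: nrmZ_le.
Qed.
Lemma nrmM x y : nrm (alg_mul x y) <= nrm x * nrm y.
Proof.
apply: nrm_le; first by rewrite mulr_ge0 ?nrm_ge0.
by apply: bnd_comp; [exact: nrm_ge0|exact: bnd_nrm|exact: bnd_nrm].
Qed.

Let nrmC x : C := (nrm x)%:C%C.
Let nrmC_D x y : nrmC (x + y) <= nrmC x + nrmC y.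
Proof. by rewrite /nrmC -rmorphD lecR nrmD. Qed.
Let nrmC_Z a x : nrmC (a *: x) = `|a| * nrmC x.
Proof. by rewrite /nrmC nrmZ normE rmorphM. Qed.
Let nrmC_eq0 x : nrmC x = 0 -> x = 0.
Proof. by case => /nrm_eq0. Qed.

HB.instance Definition _ := Lmodule_isNormed.Build C alg nrmC_D nrmC_Z nrmC_eq0.

Lemma alg_normE x : `|x| = (nrm x)%:C%C. Proof. by []. Qed.

End AlgebraType.

(** * Completeness of the algebra *)

Section Completeness.
Variable R : realType.
Notation C := R[i].
Variable H : {poly C} -> R -> Prop.
Notation A := (alg H).
Implicit Types (x y z : A) (a : C) (e t s : R).

Lemma ball_nrm x y (e : R) : ball x e%:C%C y <-> nrm (x - y) < e.
Proof. by rewrite -ball_normE /ball_ /= alg_normE ltcR. Qed.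

Lemma nrmN x : nrm (- x) = nrm x.
Proof. by rewrite -scaleN1r nrmZ cnN cn1 mul1r. Qed.
Lemma nrmB x y : nrm (x - y) = nrm (y - x).
Proof. by rewrite -nrmN opprB. Qed.
Lemma nrm_trans y x z : nrm (x - z) <= nrm (x - y) + nrm (y - z).
Proof. by apply: le_trans _ (nrmD _ _); rewrite addrA subrK. Qed.

Lemma pos_complex a : 0 < a -> exists2 r : R, 0 < r & a = r%:C%C.
Proof.
case: a => r b; rewrite ltcE /= => /andP[/eqP b0 r0]; rewrite b0.
by exists r => //; congr (_ +i* _)%C.
Qed.

(** The limit operator is built coordinatewise on each functional, then shown to be bounded and to
    lie in the closure. *)
Lemma alg_limit (x : nat -> A) (d : nat -> R) :
  (forall k l, nrm (x k - x l) <= d k + d l) ->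
  (forall e, 0 < e -> exists k0, forall k, (k0 <= k)%N -> d k <= e) ->
  exists L : A, forall k, nrm (L - x k) <= d k.
Proof.
move=> hx hd; pose T k := opval (x k).
have d0 k : 0 <= d k.
  have := le_trans (nrm_ge0 _) (hx k k).
  by rewrite -[d k + d k]mulr2n pmulrn_lge0.
have hT k l : bnd H (d k + d l) (T k - T l).
  by apply: bnd_le (hx k l) _; exact: (bnd_nrm (x k - x l)).
have hL (f : nat -> C) : exists g : nat -> C, forall k t, 0 <= t -> Psi H t f ->
    forall i, cn (g i - T k f i) <= (d k * t) *+ 2.
  have [[t t0 hf]|nd] := pselect (dualb H f); last first.
    by exists 0 => k t t0 hf; case: nd; exists t.
  suff : exists g : nat -> C, forall k s, 0 <= s -> s <= t -> Psi H s f ->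
      forall i, cn (g i - T k f i) <= (d k * s) *+ 2.
    move=> [g hg]; exists g => k s s0 hs.
    have [st|ts] := leP s t; first exact: hg.
    move=> i; apply: le_trans (hg k t t0 (lexx _) hf i) _.
    by rewrite ler_wMn2r// ler_wpM2l// ltW.
  (* [m] is the dual norm of [f]. Working with it yields one limit [g] whose error bound serves
     every admissible radius at once. *)
  pose m := inf [set s | 0 <= s /\ Psi H s f]%classic.
  have hi : has_inf [set s | 0 <= s /\ Psi H s f]%classic.
    by split; [exists t|exists 0 => s []].
  have m0 : 0 <= m by apply: lb_le_inf; [exists t|move=> s []].
  have hm : Psi H m f.
    apply: Psi_eps => e e0; have [s [s0 hs] hlt] := inf_adherent e0 hi.
    exact: Psi_le (ltW hlt) hs.
  have hk k l i : cn (T k f i - T l f i) <= d k * m + d l * m.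
    have := hT k l m f m0 hm _ _ (monXn H i).
    by rewrite evXn mulr1 mulrDl.
  have /choice [g hg] : forall i, exists w : C, forall k, cn (w - T k f i) <= (d k * m) *+ 2.
    by move=> i; apply: complex_limit => k l; exact: hk.
  exists g => k s s0 st hs i; apply: le_trans (hg i k) _.
  by rewrite ler_wMn2r// ler_wpM2l//; apply: ge_inf; [exact: hi.2|split].
have [T' hT'] := choice hL.
pose L f := if `[< dualb H f >] then T' f else 0.
have LE f : dualb H f -> L f = T' f by move=> h; rewrite /L asboolT.
have bL k : bnd H (d k) (L - T k).
  move=> t f t0 hf.
  have df : dualb H f by exists t.
  rewrite op_subE LE//.
  apply: Psi_eps => e e0; have t1 : 0 < t + 1 by rewrite ltr_wpDl.
  have small e' : 0 < e' -> exists k0, forall l, (k0 <= l)%N -> d l * t <= e'.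
    move=> e'0; have [|k0 hk0] := hd (e' / (t + 1)); first exact: divr_gt0.
    exists k0 => l /hk0 h; apply: le_trans (_ : e' / (t + 1) * t <= _).
      by rewrite ler_wpM2r.
    by rewrite mulrAC ler_pdivrMr// ler_pM2l//; lra.
  (* The factor 2 of the coordinatewise limit affects only the convergence. The bound itself comes
     from [T l - T k], so [d k] is recovered without loss. *)
  apply: (@Psi_lim _ H (fun l => T l f - T k f) (fun l => (d l * t) *+ 2)).
  - by move=> l i; rewrite !fctE opprB addrA subrK; exact: hT'.
  - move=> e' e'0; have [|k0 hk0] := small (e' / 2); first exact: divr_gt0.
    by exists k0 => l /hk0 h; rewrite mulr2n [leRHS]splitr lerD.
  - have [k0 hk0] := small e e0.
    move=> u w m; exists k0 => l /hk0 h.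
    apply: Psi_le (hT l k t f t0 hf) _ _ m.
    by rewrite mulrDl addrC lerD2l.
have iL : inA H L.
  split=> [f nd|e e0]; first by rewrite /L asboolF.
  have e2 : 0 < e / 2 by rewrite divr_gt0.
  have [k0 /(_ _ (leqnn _)) hk0] := hd _ e2.
  have [v hv] := (opvalP (x k0)).2 _ e2.
  exists v; have -> : e = e / 2 + e / 2 by lra.
  exact: bnd_sub (bnd_le hk0 (bL k0)) hv.
by exists (Alg iL) => k; apply: nrm_le.
Qed.

(** Balls of radius 1 / (k + 1) belonging to the filter meet pairwise, so their centres satisfy the
    hypothesis of [alg_limit]. *)
Lemma alg_complete (F : set_system A) : ProperFilter F -> cauchy F -> cvg F.
Proof.
move=> FF Fcauchy; have Fc := (cauchyP (T := A) F).1 Fcauchy.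
pose d k : R := k.+1%:R^-1.
have d0 k : 0 < d k by rewrite invr_gt0.
have hx k : exists x : A, F (ball x (d k)%:C%C).
  by apply: Fc; rewrite ltcR.
have [x Fx] := choice hx.
have xx k l : nrm (x k - x l) <= d k + d l.
  have [y [/ball_nrm yk /ball_nrm yl]] := filter_ex (filterI (Fx k) (Fx l)).
  apply: le_trans (nrm_trans y _ _) _; rewrite (nrmB y).
  by apply: lerD; exact: ltW.
have dsmall e : 0 < e -> exists k0, forall k, (k0 <= k)%N -> d k <= e.
  move=> e0; exists (Num.truncn e^-1) => k hk.
  rewrite /d -[leRHS]invrK lef_pV2 ?posrE ?invr_gt0//.
  apply: ltW; apply: lt_le_trans (truncnS_gt _) _.
  by rewrite ler_nat ltnS.
have [L hL] := alg_limit xx dsmall.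
apply/cvg_ex; exists L; apply/cvg_ballP => _ /pos_complex [e e0 ->].
have [|k0 /(_ _ (leqnn _)) hk0] := dsmall (e / 3); first exact: divr_gt0.
apply: filterS (Fx k0) => y /ball_nrm hy; apply/ball_nrm.
apply: le_lt_trans (nrm_trans (x k0) _ _) _.
by have := hL k0; move: hy; lra.
Qed.

End Completeness.

HB.instance Definition _ (R : realType) (H : {poly R[i]} -> R -> Prop) :=
  Uniform_isComplete.Build (alg H) (@alg_complete R H).

(** * Banach algebra axioms, the polynomials in the generator, and density *)

Section AlgebraLaws.
Variable R : realType.
Notation C := R[i].
Variable H : {poly C} -> R -> Prop.
Notation A := (alg H).
Implicit Types (x y z : A) (a : C) (u v : {poly C}) (e : R).
Notation mul := (@alg_mul R H).
Notation P := (@alg_poly R H).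

Lemma opval_linear x a f g : dualb H f -> dualb H g ->
  opval x (fun i => a * f i + g i) = fun i => a * opval x f i + opval x g i.
Proof. by move=> df dg; exact: inA_linear _ (opvalP x) df dg. Qed.

Lemma opval_off x f : ~ dualb H f -> opval x f = 0.
Proof. exact: (opvalP x).1. Qed.

Lemma alg_mul_linr a x y z : mul x (a *: y + z) = a *: mul x y + mul x z.
Proof.
apply: alg_inj; apply/funext => f /=; have [df|nf] := pselect (dualb H f).
  by rewrite -[RHS](opval_linear x a (inA_dualb (opvalP y) df) (inA_dualb (opvalP z) df)).
have comb0 : (fun i => a * (0 : nat -> C) i + (0 : nat -> C) i) = 0.
  by apply/funext => i; rewrite mulr0 addr0.
rewrite -[LHS]/(opval x (fun i => a * opval y f i + opval z f i)).
rewrite -[RHS]/(fun i => a * opval x (opval y f) i + opval x (opval z f) i).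
by rewrite !(opval_off _ nf) comb0 (inA0 (opvalP x)) comb0.
Qed.

Lemma alg_banach : is_banach_algebra mul.
Proof.
split; first by move=> x y z; exact: alg_inj.
split; first by move=> x y z; exact: alg_inj.
have hD x y z : mul x (y + z) = mul x y + mul x z.
  by rewrite -[y]scale1r alg_mul_linr !scale1r.
split=> //; split; first by move=> c x y; exact: alg_inj.
split; last by move=> x y; rewrite !alg_normE -rmorphM lecR nrmM.
move=> c x y; rewrite -[c *: y]addr0 alg_mul_linr.
rewrite -[RHS]addr0; congr (_ + _).
by apply: (addrI (mul x 0)); rewrite -hD !addr0.
Qed.

Lemma alg_polyD u v : P (u + v) = P u + P v.
Proof. by apply: alg_inj; rewrite /= mulrDr opaD. Qed.
Lemma alg_polyZ c u : P (c *: u) = c *: P u.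
Proof. by apply: alg_inj; rewrite /= -scalerAr opaZ. Qed.
Lemma alg_polyB u v : P (u - v) = P u - P v.
Proof. by rewrite alg_polyD -scaleN1r alg_polyZ scaleN1r. Qed.
Lemma alg_poly0 : P 0 = 0.
Proof. by rewrite -(scale0r 0) alg_polyZ scale0r. Qed.
Lemma alg_polyM u v : mul (P u) (P v) = P (u * 'X * v).
Proof. by apply: alg_inj; rewrite /= -opaM; congr opa; ring. Qed.

Lemma alg_poly_pow n : pow_pos mul (P 1) n = P 'X^n.
Proof.
elim: n => [|n IH]; first by rewrite expr0.
by rewrite /pow_pos iterS -/(pow_pos _ _ _) IH alg_polyM mul1r exprS.
Qed.
Lemma alg_poly_orbit n : unit_orbit mul (P 1) n = P ((1 + 'X) ^+ n).
Proof.
elim: n => [|n IH]; first by rewrite expr0.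
rewrite /unit_orbit iterS -/(unit_orbit _ _ _) IH alg_polyM -alg_polyD.
by congr P; rewrite exprS; ring.
Qed.

Lemma nrm_poly_le u : nrm (P u) <= wt ('X * u).
Proof. by apply: nrm_le; [exact: wt_ge0|exact: bnd_opa]. Qed.
Lemma nrm_poly_H u e : H ('X * u) e -> 0 <= e -> nrm (P u) <= e.
Proof. by move=> h e0; apply: nrm_le => //; exact: bnd_opa_H. Qed.

Lemma alg_dense_poly x e : 0 < e -> exists u, nrm (x - P u) <= e.
Proof.
move=> e0; have [u hu] := (opvalP x).2 _ e0.
by exists u; apply: nrm_le => //; exact: ltW.
Qed.

Lemma dense_alg (S : set A) :
  (forall x e, 0 < e -> exists2 y, S y & nrm (x - y) <= e) -> dense S.
Proof.
move=> h O [x Ox] oO; have /nbhs_ballP[_ /pos_complex[e e0 ->] he] := open_nbhs_nbhs (conj oO Ox).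
have [|y Sy hy] := h x (e / 2); first exact: divr_gt0.
exists y; split=> //; apply: he; apply/ball_nrm; apply: le_lt_trans hy _; lra.
Qed.

End AlgebraLaws.

(** * Imposing one relation on a functional *)

Section WeightedBounds.
Variable R : realType.
Notation C := R[i].
Implicit Types (f g : nat -> C) (u v q h : {poly C}) (s r B : R) (c : C).

(** The ball of radius K in the dual of the weighted l1 norm sum_i |u_i| s^i. *)
Definition sbd s K f := forall i, cn (f i) <= K * s ^+ i.

(* [mb s B u] is a dual form of the bound sum_i |u_i| s^i <= B. *)
Definition mb s B u := forall K f, 0 <= K -> sbd s K f -> sbd s (K * B) (act u f).

Lemma mb_le s B B' u : 0 <= s -> B <= B' -> mb s B u -> mb s B' u.
Proof.
move=> s0 BB h K f K0 hf i; apply: le_trans (h K f K0 hf i) _.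
by rewrite ler_wpM2r ?exprn_ge0// ler_wpM2l.
Qed.
Lemma mbX s : 0 <= s -> mb s s 'X.
Proof. by move=> s0 K f K0 hf i; rewrite /act -exprS evXn -mulrA -exprS. Qed.
Lemma mb1 s : mb s 1 1.
Proof. by move=> K f K0 hf i; rewrite /act mul1r evXn mulr1. Qed.
Lemma mbM s B B' u v : 0 <= B' -> mb s B u -> mb s B' v -> mb s (B * B') (u * v).
Proof.
move=> B0 hu hv K f K0 hf; rewrite -actM (mulrC B) mulrA.
by apply: hu; [exact: mulr_ge0|exact: hv].
Qed.
Lemma mbD s B B' u v : mb s B u -> mb s B' v -> mb s (B + B') (u + v).
Proof.
move=> hu hv K f K0 hf i; rewrite actDl mulrDr mulrDl.
apply: le_trans (cnD _ _) _; apply: lerD; first exact: hu.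
exact: hv.
Qed.
Lemma mbZ s c B u : mb s B u -> mb s (cn c * B) (c *: u).
Proof.
move=> hu K f K0 hf i; rewrite actZl cnM mulrCA -mulrA ler_wpM2l ?cn_ge0//.
exact: hu.
Qed.
Lemma mbN s B u : mb s B u -> mb s B (- u).
Proof. by move=> hu; rewrite -scaleN1r -[B]mul1r -(cn1 R) -(cnN 1); exact: mbZ. Qed.
Lemma mbXX s B u n : 0 <= B -> mb s B u -> mb s (B ^+ n) (u ^+ n).
Proof.
move=> B0 hu; elim: n => [|n IH]; first by rewrite !expr0; exact: mb1.
by rewrite !exprS; apply: mbM => //; exact: exprn_ge0.
Qed.
Lemma mb_wt s u : 0 <= s -> s <= 1 -> mb s (wt u) u.
Proof.
move=> s0 s1 K f K0 hf i.
rewrite /act {1}(_ : u = \sum_(i < size u) u`_i *: 'X^i); last first.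
  by rewrite -[LHS]coefK poly_def.
rewrite mulr_suml ev_sum; apply: le_trans (cn_sum _ _ _) _.
rewrite /wt mulrAC mulr_sumr; apply: ler_sum => j _.
rewrite -scalerAl evZ cnM -exprD evXn mulrC ler_wpM2r ?cn_ge0//.
apply: le_trans (hf _) _; rewrite ler_wpM2l// exprD ler_piMl ?exprn_ge0//.
exact: exprn_ile1.
Qed.
Lemma mb_Xwt s u : 0 <= s -> s <= 1 -> mb s (s * wt u) ('X * u).
Proof. by move=> s0 s1; apply: mbM; [exact: wt_ge0|exact: mbX|exact: mb_wt]. Qed.

(** The hypothesis on D is the one met by a polynomial whose roots have size O(rho). With
    coefficient j weighted by rho^j, multiplication by X followed by reduction costs rho for the
    shift and C0 rho for the subtracted multiple of D. *)
Lemma modp_Xn_bound (N : nat) (D : {poly C}) (rho C0 : R) :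
  (0 < N)%N -> D \is monic -> size D = N.+1 -> 0 < rho -> 0 <= C0 ->
  (forall j, (j < N)%N -> cn D`_j <= C0 * rho ^+ (N - j)) ->
  forall i j, (j < N)%N ->
    cn ('X^i %% D)`_j * rho ^+ j <= ((1 + C0) * rho) ^+ i.
Proof.
move=> N0 Dm sD r0 C00 hD.
have szr (p : {poly C}) : (size (p %% D)%R <= N)%N.
  by rewrite -ltnS -sD ltn_modp -size_poly_eq0 sD.
elim=> [|i IH] j jN.
  rewrite expr0 modp_small ?size_poly1 ?sD// coef1 expr0 cn_nat.
  by case: j jN => [|j] jN; rewrite ?expr0 ?mulr1 ?mul0r.
set p : {poly C} := 'X^i %% D in IH *.
have -> : 'X^(i.+1) %% D = 'X * p - p`_N.-1 *: D.
  have e : 'X * ('X^i %/ D * D + p) =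
      ('X * ('X^i %/ D) + (p`_N.-1)%:P) * D + ('X * p - p`_N.-1 *: D).
    by rewrite -mul_polyC; ring.
  rewrite exprS {1}(divp_eq 'X^i D) -/p e modpD modp_mull add0r modp_small//.
  rewrite sD ltnS; apply/leq_sizeP => k hk.
  rewrite coefB coefXM coefZ; have [->|kN] := eqVneq k N.
    have -> : D`_N = 1 by have /monicP := Dm; rewrite lead_coefE sD.
    by rewrite mulr1 gtn_eqF//= subrr.
  have kN' : (N < k)%N by rewrite ltn_neqAle eq_sym kN.
  have k0 : (k == 0)%N = false by rewrite gtn_eqF// (leq_ltn_trans _ kN').
  rewrite k0 (@nth_default _ _ D k) ?sD// mulr0 subr0 nth_default//.
  by apply: leq_trans (szr _) _; rewrite -ltnS prednK// (leq_ltn_trans _ kN').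
rewrite coefB coefXM coefZ.
have B0 : 0 <= ((1 + C0) * rho) ^+ i by rewrite exprn_ge0// mulr_ge0 ?addr_ge0 ?(ltW r0).
apply: le_trans (_ : (cn (if j == 0 then 0 else p`_j.-1) + cn p`_N.-1 * cn D`_j) * rho ^+ j <= _).
  by rewrite ler_wpM2r ?exprn_ge0 ?(ltW r0)// -cnM -[cn (_ * D`_j)]cnN cnD.
rewrite exprS; set Y := _ ^+ i in B0 IH *.
have -> : (1 + C0) * rho * Y = rho * Y + C0 * rho * Y by ring.
rewrite mulrDl; apply: lerD.
  case: j jN => [|j] jN /=; first by rewrite cn0 mul0r mulr_ge0// ltW.
  by rewrite exprS mulrCA ler_wpM2l ?(ltW r0)// IH// ltnW.
have hN : cn p`_N.-1 * rho ^+ N.-1 <= Y by apply: IH; rewrite prednK.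
apply: le_trans (_ : cn p`_N.-1 * (C0 * rho ^+ (N - j)) * rho ^+ j <= _).
  by rewrite ler_wpM2r ?exprn_ge0 ?(ltW r0)// ler_wpM2l ?cn_ge0// hD.
have -> : cn p`_N.-1 * (C0 * rho ^+ (N - j)) * rho ^+ j
   = C0 * rho * (cn p`_N.-1 * rho ^+ N.-1).
  have this : rho * (cn p`_N.-1 * rho ^+ N.-1) = cn p`_N.-1 * (rho ^+ (N - j) * rho ^+ j).
    by rewrite -exprD subnK 1?ltnW// mulrCA -exprS prednK.
  rewrite -(mulrA C0) this; ring.
by rewrite ler_wpM2l// mulr_ge0// ltW.
Qed.

End WeightedBounds.

(** * The perturbation step, and relations of the first shape *)

Section Step.
Variable R : realType.
Notation C := R[i].
Implicit Types (phi psi : nat -> C) (u v q h D : {poly C}) (s r B rho kap eps del : R).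

Lemma exists_half_pow K del : 0 < del -> exists M : nat, K * 2^-1 ^+ M <= del.
Proof.
move=> d0; have [M hM] : exists M : nat, `|K| / del < M%:R.
  by exists (Num.truncn (`|K| / del)).+1; exact: truncnS_gt.
exists M.
have h2 : (M%:R : R) <= 2 ^+ M by rewrite -natrX ler_nat ltnW// ltn_expl.
rewrite exprVn ler_pdivrMr ?exprn_gt0//.
apply: le_trans (ler_norm K) _; rewrite mulrC -ler_pdivrMr//.
by apply: le_trans (ltW hM) h2.
Qed.

(* phi' u = phi (u mod D) vanishes on the multiples of h and agrees with phi in
   degrees < N; psi is a truncation of phi' beyond a large degree M. *)
Lemma functional_step (Fam : {poly C} -> Prop) (N : nat) phi r eps del (C0 : R) :
  (0 < N)%N -> (forall i, (N <= i)%N -> phi i = 0) ->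
  0 < r -> 0 < eps -> 0 < del -> 0 <= C0 ->
  (forall kap, 0 < kap -> exists rho h D, [/\ 0 < rho, rho < kap, Fam h &
     [/\ D \is monic, size D = N.+1,
      forall j, (j < N)%N -> cn D`_j <= C0 * rho ^+ (N - j), D %| h &
      mb (2 * (1 + C0) * rho) eps h]]) ->
  exists h s psi, [/\ Fam h, 0 < s, s <= r,
    exists M, forall i, (M <= i)%N -> psi i = 0 &
    [/\ forall i, cn (psi i - phi i) <= del * r ^+ i,
      mb s eps h & sbd s del (act h psi)]].
Proof.
move=> N0 phi0 r0 e0 d0 C00 hyp.
pose Fm : R := \sum_(j < N) cn (phi j) + 1.
have Fm0 : 0 < Fm by rewrite ltr_wpDl// sumr_ge0// => i _; exact: cn_ge0.
pose B : R := 1 + C0.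
have B0 : 0 < B by rewrite /B ltr_pwDl.
(* The three bounds give rho < 1, then 2 B rho <= r, and then B^N rho Fm <= del r^N, which controls
   the degrees >= N. *)
pose kap := Num.min (Num.min 1 (r / (2 * B))) (del * r ^+ N / (B ^+ N * Fm)).
have kap0 : 0 < kap by rewrite !lt_min ltr01 !divr_gt0 ?mulr_gt0 ?exprn_gt0.
have [rho [h [D [rho0 rk Fh [Dm sD hD Dh hmb]]]]] := hyp _ kap0.
move: rk; rewrite !lt_min -andbA => /and3P[rho1 rhor rhoN].
have rB : 2 * B * rho <= r by rewrite mulrC -ler_pdivlMr ?mulr_gt0// ltW.
have rN : B ^+ N * rho * Fm <= del * r ^+ N.
  by rewrite mulrAC mulrC -ler_pdivlMr ?mulr_gt0 ?exprn_gt0// ltW.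
pose phi' i : C := \sum_(j < N) ('X^i %% D)`_j * phi j.
have szr (p : {poly C}) : (size (p %% D)%R <= N)%N.
  by rewrite -ltnS -sD ltn_modp -size_poly_eq0 sD.
have ev' u : ev phi' u = ev phi (u %% D).
  rewrite [in RHS](_ : u = \sum_(i < size u) u`_i *: 'X^i); last first.
    by rewrite -[LHS]coefK poly_def.
  rewrite (big_morph (fun p => p %% D) (fun p q => modpD D p q) (mod0p D)).
  rewrite ev_sum; apply: eq_bigr => i _.
  by rewrite modpZl evZ /phi' (@ev_wide _ N).
have phi'N i : (i < N)%N -> phi' i = phi i.
  by move=> iN; rewrite -(evXn phi') ev' modp_small ?evXn// size_polyXn sD.
(* The remainder estimate weights coefficient j by rho^j; the factor rho^(N-1) absorbs these weights
   for all j < N. *)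
have bd i : cn (phi' i) * rho ^+ N.-1 <= Fm * (B * rho) ^+ i.
  apply: le_trans (_ : (\sum_(j < N) cn ('X^i %% D)`_j * cn (phi j)) * rho ^+ N.-1 <= _).
    rewrite ler_wpM2r ?exprn_ge0 ?(ltW rho0)//; apply: le_trans (cn_sum _ _ _) _.
    by apply: ler_sum => j _; rewrite cnM.
  rewrite mulr_suml.
  apply: le_trans (_ : (\sum_(j < N) cn (phi j)) * (B * rho) ^+ i <= _); last first.
    by rewrite ler_wpM2r ?lerDl// exprn_ge0// mulr_ge0// ltW.
  rewrite mulr_suml; apply: ler_sum => j _.
  rewrite mulrAC mulrC ler_wpM2l ?cn_ge0//.
  apply: le_trans (modp_Xn_bound N0 Dm sD rho0 C00 hD i (ltn_ord j)).
  rewrite ler_wpM2l ?cn_ge0//; apply: (ler_wiXn2l (ltW rho0) (ltW rho1)).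
  by rewrite -ltnS prednK.
(* Twice the growth rate B rho of [phi']: measured at [s], the tail beyond M gains a factor 2^-M. *)
pose s := 2 * B * rho.
have s0 : 0 < s by rewrite !mulr_gt0.
have rp : 0 < rho ^+ N.-1 by rewrite exprn_gt0.
have rhoS : rho ^+ N = rho * rho ^+ N.-1 by rewrite -exprS prednK.
(* (B rho)^i / rho^(N-1) = B^N rho (B rho)^(i-N): the one spare factor rho makes this small. *)
have big i : (N <= i)%N -> cn (phi' i) <= del * r ^+ i.
  move=> Ni; rewrite -(ler_pM2r rp); apply: le_trans (bd i) _.
  have -> : Fm * (B * rho) ^+ i = (B ^+ N * rho * Fm) * (rho ^+ N.-1 * (B * rho) ^+ (i - N)).
    rewrite -[in LHS](subnKC Ni) exprD [_ ^+ N]exprMn rhoS; ring.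
  apply: le_trans (_ : del * r ^+ N * (rho ^+ N.-1 * r ^+ (i - N)) <= _); last first.
    by rewrite -[in leRHS](subnKC Ni) exprD le_eqVlt; apply/orP; left; apply/eqP; ring.
  apply: ler_pM => //.
  - by rewrite !mulr_ge0 ?exprn_ge0 // ltW.
  - by rewrite !mulr_ge0 ?exprn_ge0 ?mulr_ge0 // ltW.
  rewrite ler_wpM2l ?(ltW rp)// lerXn2r ?nnegrE ?mulr_ge0 ?(ltW B0) ?(ltW rho0) ?(ltW r0)//.
  apply: le_trans rB; rewrite -mulrA ler_peMl ?ler1n ?mulr_ge0 ?(ltW B0) ?(ltW rho0)//.
have K0 : 0 <= Fm / rho ^+ N.-1 by rewrite divr_ge0 ?ltW.
have [M0 hM0] := exists_half_pow (Fm / rho ^+ N.-1 * eps) d0.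
pose M := maxn M0 N.
pose psi i := if (i < M)%N then phi' i else 0.
exists h, s, psi; split=> //; first by exists M => i; rewrite /psi ltnNge => ->.
split=> //.
  move=> i; rewrite /psi; case: ltnP => iM.
    have [iN|Ni] := ltnP i N; last by rewrite (phi0 i Ni) subr0; exact: big.
    by rewrite phi'N// subrr cn0 mulr_ge0 ?exprn_ge0 ?(ltW r0) ?(ltW d0).
  rewrite phi0 ?subrr ?cn0 ?mulr_ge0 ?exprn_ge0 ?(ltW r0) ?(ltW d0)//.
  by apply: leq_trans iM; rewrite leq_maxr.
(* [theta] is the discarded tail. Since h annihilates [phi'], the action of h on [psi] is minus its
   action on [theta]. *)
pose theta i := if (i < M)%N then 0 else phi' i.
have psiE : psi = phi' - theta.
  by apply/funext => i; rewrite !fctE /psi /theta; case: ifP; rewrite ?subr0 ?subrr.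
have act' : act h phi' = 0.
  apply/funext => i; rewrite /act ev' (_ : _ %% D = 0) ?ev0//.
  by apply/eqP; rewrite -/(D %| _) dvdp_mulr.
have hKM : 0 <= Fm / rho ^+ N.-1 * 2^-1 ^+ M by rewrite mulr_ge0// exprn_ge0.
have ht : sbd s (Fm / rho ^+ N.-1 * 2^-1 ^+ M) theta.
  move=> i; rewrite /theta; case: ltnP => iM.
    by rewrite cn0 mulr_ge0// exprn_ge0// ltW.
  rewrite -(ler_pM2r rp); apply: le_trans (bd i) _.
  have -> : Fm / rho ^+ N.-1 * 2^-1 ^+ M * s ^+ i * rho ^+ N.-1 = Fm * (2^-1 ^+ M * s ^+ i).
    by field; rewrite gt_eqF.
  rewrite ler_pM2l//.
  have -> : B * rho = 2^-1 * s by rewrite /s; field.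
  rewrite exprMn ler_wpM2r ?exprn_ge0 ?(ltW s0)//.
  apply: ler_wiXn2l => //; rewrite ?invr_ge0// invf_le1 ?ler1n//.
rewrite psiE actB act' sub0r => i; rewrite cnN.
apply: le_trans (hmb _ _ hKM ht i) _; rewrite -/s ler_wpM2r ?exprn_ge0 ?(ltW s0)//.
apply: le_trans hM0; rewrite mulrAC ler_wpM2l ?(mulr_ge0 K0 (ltW e0))//.
apply: ler_wiXn2l; rewrite ?invr_ge0// ?invf_le1 ?ler1n//.
by rewrite leq_maxl.
Qed.

(** The condition 2 < N leaves an exponent at least 2 once a factor X is removed, as the second
    shape of relation requires. *)
Definition sup_rel q h := exists (c : C) (N : nat),
  (2 < N)%N /\ h = q - c *: 'X^N.

Lemma sup_step q phi r eps del : 0 < r -> 0 < eps -> 0 < del ->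
  (exists M, forall i, (M <= i)%N -> phi i = 0) ->
  exists h s psi, [/\ sup_rel ('X * q) h, 0 < s, s <= r,
    exists M, forall i, (M <= i)%N -> psi i = 0 &
    [/\ forall i, cn (psi i - phi i) <= del * r ^+ i,
      mb s eps h & sbd s del (act h psi)]].
Proof.
move=> r0 e0 d0 [M hM].
pose N := maxn M (maxn 3 (size ('X * q))).
have N3 : (2 < N)%N by rewrite !leq_max leqnn orbT.
have N0 : (0 < N)%N by apply: leq_trans N3.
have Nq : (size ('X * q)%R <= N)%N by rewrite !leq_max leqnn !orbT.
pose C0 := wt q.
have C00 : 0 <= C0 by exact: wt_ge0.
pose B := 1 + C0.
have B0 : 0 < B by rewrite /B ltr_pwDl.
apply: (@functional_step (sup_rel ('X * q)) N phi r eps del C0) => //.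
  by move=> i iN; apply: hM; apply: leq_trans iN; rewrite leq_maxl.
move=> kap kap0.
(* Chosen so that the weighted norm of h at s = 2 B rho is at most L rho. *)
pose L := 2 * B * wt q + (2 * B) ^+ N.
have L0 : 0 <= L by rewrite addr_ge0 ?mulr_ge0 ?exprn_ge0 ?mulr_ge0 ?wt_ge0 ?(ltW B0).
pose rho := Num.min (Num.min (kap / 2) (2 * B)^-1) (eps / (L + 1)).
have L1 : 0 < L + 1 by rewrite ltr_wpDl.
have rho0 : 0 < rho by rewrite !lt_min invr_gt0 !divr_gt0 ?mulr_gt0.
have rhok : rho < kap.
  by rewrite /rho !gt_min (_ : kap / 2 < kap)//; lra.
have rhoB : rho <= (2 * B)^-1 by rewrite /rho !ge_min lexx !orbT.
have rhoe : rho <= eps / (L + 1) by rewrite /rho !ge_min lexx !orbT.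
have s1 : 2 * B * rho <= 1 by rewrite mulrC -ler_pdivlMr ?mulr_gt0// mul1r.
have rho1 : rho <= 1.
  apply: le_trans s1; rewrite ler_peMl ?(ltW rho0)//.
  by rewrite /B; move: C00; lra.
have rp : 0 < rho ^+ N.-1 by rewrite exprn_gt0.
(* D = X^N - a X q has no constant term, and for j >= 1 its coefficients are at most wt q rho^(N-1)
   <= C0 rho^(N-j). The term a^-1 X^N of h has weighted norm rho^-(N-1) s^N, which is still
   O(rho). *)
pose a : C := (rho ^+ N.-1)%:C%C.
have a0 : a != 0 by rewrite -cn_gt0 cn_real normr_gt0 gt_eqF.
have cna : cn a = rho ^+ N.-1 by rewrite cn_real gtr0_norm.
exists rho, ('X * q - a^-1 *: 'X^N), ('X^N - a *: ('X * q)); split=> //.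
  by exists a^-1, N.
have szaq : (size (- (a *: ('X * q))) < size ('X^N : {poly C}))%N.
  by rewrite size_polyN size_polyXn ltnS (leq_trans (size_scale_leq _ _)).
split.
- by rewrite monicE lead_coefDl// lead_coefXn.
- by rewrite size_polyDl// size_polyXn.
- move=> j jN; rewrite coefB coefXn ltn_eqF// sub0r cnN coefZ coefXM cnM cna.
  case: j jN => [|j] jN /=; first by rewrite cn0 mulr0 mulr_ge0 ?exprn_ge0 ?(ltW rho0).
  rewrite mulrC; apply: ler_pM; rewrite ?cn_ge0 ?(ltW rp)//.
    have [jq|jq] := ltnP j (size q); last by rewrite nth_default// cn0.
    rewrite /C0 /wt (bigD1 (Ordinal jq))//= lerDl sumr_ge0// => i _; exact: cn_ge0.
  by apply: (ler_wiXn2l (ltW rho0) rho1); rewrite -subn1 leq_sub2l.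
- have -> : 'X * q - a^-1 *: 'X^N = (- a^-1) *: ('X^N - a *: ('X * q)).
    by rewrite scalerBr scaleNr scaleNr scalerA mulVf// scale1r opprK addrC.
  by rewrite dvdpZr ?oppr_eq0 ?invr_eq0.
have s0 : 0 <= 2 * B * rho by rewrite !mulr_ge0 ?(ltW B0) ?(ltW rho0).
apply: (@mb_le _ _ (2 * B * rho * wt q + cn a^-1 * (2 * B * rho) ^+ N)) => //; last first.
  apply: mbD; first exact: mb_Xwt.
  apply: mbN; apply: mbZ; exact: mbXX s0 (mbX s0).
have -> : 2 * B * rho * wt q + cn a^-1 * (2 * B * rho) ^+ N = L * rho.
  have rhoS : rho ^+ N = rho ^+ N.-1 * rho by rewrite -exprSr prednK.
  rewrite cnV cna exprMn rhoS [_^-1 * _]mulrCA mulKf ?(gt_eqF rp)// /L.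
  by rewrite [RHS]mulrDl [_ * rho * _]mulrAC.
apply: le_trans (_ : L * (eps / (L + 1)) <= _); first by rewrite ler_wpM2l.
by rewrite mulrCA ler_piMr ?(ltW e0)// ler_pdivrMr// mul1r lerDl.
Qed.

End Step.

(** * Roots of unity, and location of the roots of polynomials *)

Section Roots.
Variable R : realType.
Notation C := R[i].
Implicit Types (z w lam c : C) (x r rho : R) (rs : seq C) (p : {poly C}).

Lemma sin_le_id x : 0 <= x -> sin x <= x.
Proof.
move=> x0; have [y _] : exists2 y : R, y \in `[0, x]%R & sin x - sin 0 = cos y * (x - 0).
  apply: (@MVT_segment R sin cos 0 x x0).
  by apply: continuous_subspaceT => y; exact: continuous_sin.
rewrite sin0 !subr0 => ->; rewrite ler_piMl//; exact: cos_le1.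
Qed.

Definition cis x : C := (cos x +i* sin x)%C.

Lemma cisD x y : cis (x + y) = cis x * cis y.
Proof. by apply/eqP; rewrite eq_complex /= cosD sinD [sin x * _ + _]addrC !eqxx. Qed.
Lemma cis_pow x n : cis x ^+ n = cis (x *+ n).
Proof.
elim: n => [|n IH]; last by rewrite exprS IH -cisD mulrS.
by rewrite expr0 mulr0n /cis cos0 sin0.
Qed.
Lemma cn_cis x : cn (cis x) = 1.
Proof. by rewrite /cn /= cos2Dsin2 sqrtr1. Qed.

(** The chord has length 2 sin (x / 2). *)
Lemma cn_cis_sub1 x : 0 <= x -> x <= pi -> cn (cis x - 1) <= x.
Proof.
move=> x0 xpi; pose y := x / 2.
have y0 : 0 <= y by rewrite divr_ge0.
have xy : x = y *+ 2 by rewrite mulr2n -splitr.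
have sy0 : 0 <= sin y.
  by apply: sin_ge0_pi; rewrite y0 ler_pdivrMr//; move: xpi x0; lra.
have -> : cn (cis x - 1) = Num.sqrt ((cos x - 1) ^+ 2 + sin x ^+ 2).
  by rewrite /cn /= subr0.
have -> : (cos x - 1) ^+ 2 + sin x ^+ 2 = (sin y *+ 2) ^+ 2.
  have -> : (cos x - 1) ^+ 2 + sin x ^+ 2 = (cos x ^+ 2 + sin x ^+ 2) + 1 - cos x *+ 2.
    by rewrite !mulr2n; ring.
  rewrite cos2Dsin2 xy cos_mulr2n; have := cos2Dsin2 y.
  by move: (cos y) (sin y) => a b h; rewrite !mulr2n; nra.
by rewrite sqrtr_sqr ger0_norm ?mulrn_wge0// xy ler_wMn2r// sin_le_id.
Qed.

Lemma cn_pow_sub1 w t : cn w = 1 -> cn (w ^+ t - 1) <= t%:R * cn (w - 1).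
Proof.
move=> w1; elim: t => [|t IH]; first by rewrite expr0 subrr cn0 mul0r.
rewrite exprS (_ : w * w ^+ t - 1 = w * (w ^+ t - 1) + (w - 1)); last by ring.
by apply: le_trans (cnD _ _) _; rewrite cnM w1 mul1r -natr1 mulrDl mul1r lerD2r.
Qed.

(** Take w = exp (i pi / 2^k). For d = 2^a b with b odd, the power 2^(k-a) of w^d is -1, so 2 <=
    2^(k-a) |w^d - 1| by [cn_pow_sub1]. Using a power of two thus avoids lower bounds on sines. *)
Lemma unity_root_near k : exists w : C, [/\ cn w = 1, w ^+ (2 ^ k) = -1,
  cn (w - 1) <= 4 / (2 ^ k)%:R &
  forall d, (0 < d < 2 ^ k)%N -> 2 / (2 ^ k)%:R <= cn (w ^+ d - 1)].
Proof.
set m := (2 ^ k)%N; have m0 : (0 < m%:R :> R) by rewrite ltr0n expn_gt0.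
have m1 : (1 <= m%:R :> R) by rewrite ler1n expn_gt0.
pose w := cis (pi / m%:R); have w1 : cn w = 1 by exact: cn_cis.
have wm : w ^+ m = -1.
  rewrite cis_pow -[_ *+ m]mulr_natr mulfVK ?gt_eqF// /cis cospi sinpi.
  by apply/eqP; rewrite eq_complex /= oppr0 !eqxx.
exists w; split=> //.
  apply: le_trans (cn_cis_sub1 _ _) _; first by rewrite divr_ge0 ?pi_ge0 ?ltW.
    by rewrite ler_pdivrMr// ler_peMr ?pi_ge0.
  by rewrite ler_pM2r ?invr_gt0//; have /andP[_] := @pihalf_02 R; lra.
move=> d /andP[d0 dm].
pose a := logn 2 d; pose b := (d %/ 2 ^ a)%N.
have dab : d = (2 ^ a * b)%N by rewrite mulnC divnK// pfactor_dvdn.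
have b_odd : odd b.
  have [b' hb db] := @pfactor_coprime 2 d isT d0.
  have -> : b = b' by rewrite /b {1}db mulnK// expn_gt0.
  by move: hb; rewrite coprime2n.
have ak : (a <= k)%N.
  rewrite leqNgt; apply/negP => ka; move: dm; rewrite ltnNge /m.
  have -> : (2 ^ k <= d)%N => //.
  rewrite dab; apply: leq_trans (_ : 2 ^ a <= _)%N; first by rewrite leq_exp2l// ltnW.
  by rewrite leq_pmulr//; case: (b) b_odd.
have h : w ^+ d ^+ (2 ^ (k - a)) = -1.
  rewrite -exprM dab mulnAC -expnD subnKC// exprM wm -signr_odd b_odd expr1//.
have := @cn_pow_sub1 (w ^+ d) (2 ^ (k - a)).
rewrite h cnX w1 expr1n => /(_ erefl).
have -> : cn (-1 - 1 : C) = 2.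
  by rewrite -opprD cnN (_ : 1 + 1 = 2%:R) ?cn_nat// -natrD.
move=> h2; rewrite ler_pdivrMr// mulrC; apply: le_trans h2 _.
by rewrite ler_wpM2r ?cn_ge0// ler_nat leq_exp2l// leq_subr.
Qed.

(** The logarithmic derivative is a sum of terms of modulus at most 1 / r; the denominators are
    cleared so that p(lam) may vanish. *)
Lemma prod_XsubC_deriv_bound rs lam r : 0 <= r ->
  (forall z, z \in rs -> r <= cn (lam - z)) ->
  r * cn (\prod_(z <- rs) ('X - z%:P))^`().[lam] <=
    (size rs)%:R * cn (\prod_(z <- rs) ('X - z%:P)).[lam].
Proof.
move=> r0; elim: rs => [|z rs IH] h.
  by rewrite big_nil derivC horner0 cn0 mulr0 mul0r.
rewrite !big_cons derivM derivXsubC mul1r hornerD !hornerM hornerXsubC.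
set q := \prod_(_ <- _) _ in IH *.
have hz : r <= cn (lam - z) by apply: h; rewrite mem_head.
apply: le_trans (_ : r * (cn q.[lam] + cn (lam - z) * cn q^`().[lam]) <= _).
  by rewrite ler_wpM2l// -cnM cnD.
rewrite mulrDr cnM -[size (z :: rs)]/(size rs).+1 -natr1 mulrDl mul1r addrC.
apply: lerD; last by rewrite ler_wpM2r ?cn_ge0.
rewrite mulrCA [leRHS]mulrCA ler_wpM2l ?cn_ge0//; apply: IH => y ys.
by apply: h; rewrite in_cons ys orbT.
Qed.

Lemma seq_argmin rs lam : rs != [::] ->
  exists2 z, z \in rs & forall y, y \in rs -> cn (lam - z) <= cn (lam - y).
Proof.
elim: rs => // a rs IH _; have [->|/IH [z zs hz]] := eqVneq rs [::].
  by exists a; rewrite ?mem_head// => y; rewrite mem_seq1 => /eqP ->.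
have [az|za] := leP (cn (lam - a)) (cn (lam - z)).
  exists a; rewrite ?mem_head// => y; rewrite in_cons => /orP[/eqP ->//|/hz].
  exact: le_trans.
exists z; first by rewrite in_cons zs orbT.
by move=> y; rewrite in_cons => /orP[/eqP ->|/hz//]; exact: ltW.
Qed.

(* p'/p is the sum of the 1 / (lam - z) over the roots z of p, so a root of
   least distance d satisfies |p'(lam)| <= deg p * |p(lam)| / d. *)
Lemma root_near p lam : p^`().[lam] != 0 ->
  exists2 x, root p x &
    cn (lam - x) * cn p^`().[lam] <= (size p).-1%:R * cn p.[lam].
Proof.
move=> p'0; have p0 : p != 0.
  by apply: contraNneq p'0 => ->; rewrite derivC horner0.
have [rs rsE] := closed_field_poly_normal p.
have lc0 : lead_coef p != 0 by rewrite lead_coef_eq0.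
have srs : size p = (size rs).+1.
  by rewrite rsE size_scale// size_prod_XsubC.
have [rs0|rs0] := eqVneq rs [::].
  by move: p'0; rewrite rsE rs0 big_nil derivZ derivC scaler0 horner0 eqxx.
have [x xs hx] := seq_argmin lam rs0.
exists x; first by rewrite rsE rootZ// root_prod_XsubC.
rewrite srs /= rsE derivZ !hornerZ !cnM mulrCA [leRHS]mulrCA ler_wpM2l ?cn_ge0//.
by apply: prod_XsubC_deriv_bound; rewrite ?cn_ge0.
Qed.

(** The coefficients are elementary symmetric functions of the roots. The constant depends only on
    the number of roots, as [functional_step] needs when rho tends to 0. *)
Lemma prod_XsubC_coef_bound rs rho : 0 <= rho ->
  (forall z, z \in rs -> cn z <= rho) ->
  forall j, (j <= size rs)%N ->
    cn (\prod_(z <- rs) ('X - z%:P))`_j <= 2 ^+ size rs * rho ^+ (size rs - j).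
Proof.
move=> r0; elim: rs => [|z rs IH] h j hj.
  move: hj; rewrite leqn0 => /eqP ->.
  by rewrite big_nil coef1 cn_nat /= !expr0 mulr1.
rewrite big_cons; set q := \prod_(_ <- _) _ in IH *.
have hz : cn z <= rho by apply: h; rewrite mem_head.
have {}IH : forall j, (j <= size rs)%N -> cn q`_j <= 2 ^+ size rs * rho ^+ (size rs - j).
  by apply: IH => y ys; apply: h; rewrite in_cons ys orbT.
have pos i : 0 <= 2 ^+ size rs * rho ^+ i by rewrite mulr_ge0 ?exprn_ge0.
rewrite mulrBl coefB coefXM coefCM; apply: le_trans (cnD _ _) _; rewrite cnN cnM.
rewrite [size (z :: rs)]/= [2 ^+ _.+1]exprS -mulrA mulr_natl mulr2n; apply: lerD.
  case: j hj => [|j] hj; first by rewrite /= cn0.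
  by rewrite /= subSS IH.
move: hj; rewrite leq_eqVlt => /orP[/eqP ->|].
  by rewrite nth_default ?size_prod_XsubC// cn0 mulr0.
rewrite ltnS => hj; rewrite subSn// exprS mulrCA; apply: ler_pM; rewrite ?cn_ge0//.
exact: IH.
Qed.

End Roots.

(** * Relations of the second shape *)

Section HyperStep.
Variable R : realType.
Notation C := R[i].
Implicit Types (phi psi : nat -> C) (c : C) (s r rho eps del : R) (h D : {poly C}).

Lemma nat_gt (x : R) : exists M : nat, x < M%:R.
Proof. by exists (Num.truncn x).+1; exact: truncnS_gt. Qed.

(* The roots of D are the roots of 1 + c X^e - (1 + X)^n nearest to w^j - 1 for
   j < N. As e >= 2, the value there is O(n^-2), so they are within O(n^-2) of
   these points, which are 4 / n apart. *)
Lemma hyp_roots c (e N : nat) : (1 < e)%N -> (0 < N)%N ->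
  exists2 K : R, 0 < K & forall kap : R, 0 < kap -> exists n rho D,
   [/\ (0 < n)%N, 0 < rho, rho < kap, n%:R * rho <= K &
   [/\ D \is monic, size D = N.+1,
     forall j, (j < N)%N -> cn D`_j <= 2 ^+ N * rho ^+ (N - j) &
     D %| 1 + c *: 'X^e - (1 + 'X) ^+ n]].
Proof.
(* The points w^j - 1 have modulus at most 4 N / M, and the chosen roots are within 1 / M of them,
   so rho = Q / M bounds the roots. *)
move=> e1 N0; pose Q : R := 4 * N%:R + 1.
have N1 : (1 <= N%:R :> R) by rewrite ler1n.
have Q0 : 0 < Q by rewrite /Q; lra.
exists (2 * Q) => [|kap kap0]; first by rewrite mulr_gt0.
pose g := cn c; have g0 : 0 <= g by exact: cn_ge0.
have e0 : 0 <= e%:R :> R by [].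
(* The summands are nonnegative and k < 2^k = M, so M exceeds each of them. *)
have [k hk] := nat_gt (e%:R * (g + 1) + N%:R + 4 * N%:R + 32 * g * N%:R ^+ 2 + Q / kap).
pose m := (2 ^ k)%N; pose M : R := m%:R.
have kM : k%:R < M by rewrite ltr_nat ltn_expl.
have t1 : 0 <= e%:R * (g + 1) by rewrite mulr_ge0 ?addr_ge0.
have t2 : 0 <= 32 * g * N%:R ^+ 2 by rewrite !mulr_ge0 ?exprn_ge0.
have t3 : 0 < Q / kap by rewrite divr_gt0.
have M0 : 0 < M by rewrite /M ltr0n expn_gt0.
have eM : e%:R * (g + 1) <= M by move: t1 t2 t3 hk kM; lra.
have NM : N%:R < M by move: t1 t2 t3 hk kM; lra.
have N4M : 4 * N%:R <= M by move: t1 t2 t3 hk kM; lra.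
have gM : 32 * g * N%:R ^+ 2 < M by move: t1 t2 t3 hk kM; lra.
have QM : Q / kap < M by move: t1 t2 t3 hk kM; lra.
have [w [w1 wm w_near w_far]] := unity_root_near R k; rewrite -/m -/M in wm w_near w_far.
(* Since w^m = -1, this is the exponent with w^n = 1; hence (1 + lam)^n = 1 at each point lam = w^j
   - 1. *)
pose n := (m * 2)%N.
have n0 : (0 < n)%N by rewrite muln_gt0 expn_gt0.
have nM : n%:R = M * 2 :> R by rewrite natrM.
have wn : w ^+ n = 1 by rewrite exprM wm sqrrN expr1n.
pose P : {poly C} := 1 + c *: 'X^e - (1 + 'X) ^+ n.
have em : (e <= n)%N.
  rewrite -(ler_nat R) nM; apply: le_trans (_ : M <= _); last by move: M0; lra.
  by apply: le_trans eM; rewrite ler_peMr// lerDr.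
have szP : (size P <= n.+1)%N.
  have s1X : size (1 + 'X : {poly C}) = 2 by rewrite addrC -['X + 1]/('X + 1%:P) size_XaddC.
  apply: leq_trans (size_polyD _ _) _; rewrite geq_max size_polyN; apply/andP; split.
    apply: leq_trans (size_polyD _ _) _; rewrite geq_max size_poly1 /=.
    by apply: leq_trans (size_scale_leq _ _) _; rewrite size_polyXn ltnS.
  by apply: leq_trans (size_poly_exp_leq _ _) _; rewrite s1X mul1n.
pose lam j : C := w ^+ j - 1.
have lam_le j : (j < N)%N -> cn (lam j) <= 4 * N%:R / M.
  move=> jN; apply: le_trans (cn_pow_sub1 _ w1) _.
  rewrite [4 * _]mulrC -mulrA; apply: ler_pM; rewrite ?cn_ge0//.
  by rewrite ler_nat ltnW.
have lam1 j : (j < N)%N -> cn (lam j) <= 1.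
  by move=> jN; apply: le_trans (lam_le j jN) _; rewrite ler_pdivrMr// mul1r.
have lamD j : 1 + lam j = w ^+ j by rewrite addrC subrK.
have Plam j : P.[lam j] = c * lam j ^+ e.
  rewrite /P !(hornerD, hornerN, hornerZ, horner_exp, hornerX, hornerC) lamD.
  by rewrite -exprM mulnC exprM wn expr1n; ring.
have P'lam j : P^`().[lam j] = c * (lam j ^+ e.-1 *+ e) - w ^+ j ^+ n.-1 *+ n.
  rewrite /P derivB derivD derivZ derivXn deriv_exp derivD derivX.
  have -> : (1 : {poly C})^`() = 0 by exact: derivC.
  rewrite !add0r mul1r.
  by rewrite !(hornerD, hornerN, hornerZ, hornerMn, horner_exp, hornerX, hornerC) lamD.
have cnMn (z : C) i : cn (z *+ i) = cn z * i%:R by rewrite -[z *+ i]mulr_natr cnM cn_nat.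
(* The term coming from (1 + X)^n has modulus n = 2 M, the one from c X^e at most M. *)
have P'big j : (j < N)%N -> M <= cn P^`().[lam j].
  move=> jN; have h1 : cn (w ^+ j ^+ n.-1 *+ n) = M * 2.
    by rewrite cnMn !cnX w1 !expr1n mul1r nM.
  have h2 : cn (c * (lam j ^+ e.-1 *+ e)) <= M.
    apply: le_trans eM; rewrite cnM cnMn cnX -/g [e%:R * _]mulrC mulrA.
    rewrite ler_wpM2r// ; apply: le_trans (_ : g * 1 <= _); last by rewrite mulr1 lerDl.
    by rewrite ler_wpM2l// exprn_ile1 ?cn_ge0 ?lam1.
  pose u := c * (lam j ^+ e.-1 *+ e); pose v := w ^+ j ^+ n.-1 *+ n.
  have := cnD (u - v) (- u); rewrite addrAC subrr sub0r !cnN.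
  by rewrite -/v -/u in h1 h2 *; rewrite h1 P'lam; move: h2; lra.

(* The bound j < N sits under the existential so that [choice] yields a function on all of [nat]. *)
have rootx j : exists x : C, (j < N)%N -> root P x /\ cn (x - lam j) < M^-1.
  have [jN|_] := ltnP j N; last by exists 0.
  have P'0 : P^`().[lam j] != 0 by rewrite -cn_gt0; exact: lt_le_trans (P'big j jN).
  have [x Px hx] := root_near P'0; exists x => _; split=> //.
  have h3 : cn P.[lam j] <= g * (4 * N%:R / M) ^+ 2.
    rewrite Plam cnM cnX ler_wpM2l//; apply: le_trans (_ : cn (lam j) ^+ 2 <= _).
      exact: (ler_wiXn2l (cn_ge0 _) (lam1 j jN)).
    by rewrite lerXn2r ?nnegrE ?cn_ge0 ?lam_le// divr_ge0 ?mulr_ge0 ?(ltW M0).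
  have h4 : cn (x - lam j) * M <= M * 2 * (g * (4 * N%:R / M) ^+ 2).
    rewrite cnB; apply: le_trans (_ : cn (lam j - x) * cn P^`().[lam j] <= _).
      by rewrite ler_wpM2l ?cn_ge0 ?P'big.
    apply: le_trans hx _; apply: ler_pM => //; first exact: cn_ge0.
    by rewrite -nM ler_nat; move: szP; case: (size P).
  rewrite -[X in X < _](mulfK (lt0r_neq0 M0)) ltr_pdivrMr// mulVf ?lt0r_neq0//.
  apply: le_lt_trans h4 _.
  have -> : M * 2 * (g * (4 * N%:R / M) ^+ 2) = 32 * g * N%:R ^+ 2 / M.
    by field; rewrite lt0r_neq0.
  by rewrite ltr_pdivrMr// mul1r.
have {rootx} [x hx] := choice rootx.
pose rs := [seq x j | j <- iota 0 N].
have srs : size rs = N by rewrite size_map size_iota.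
pose rho := Q / M.
have rho0 : 0 < rho by rewrite divr_gt0.
have rs_le z : z \in rs -> cn z <= rho.
  move=> /mapP [j]; rewrite mem_iota => /andP[_ jN] ->.
  have [_ /ltW h] := hx j jN; have hl := lam_le j jN.
  have := cn_trans (lam j) (x j) 0; rewrite !subr0 => /le_trans; apply.
  by rewrite /rho /Q mulrDl mul1r addrC lerD.
(* The points [lam i] and [lam j] are at least 2 / M apart, and each root is strictly within 1 / M
   of its point. *)
have xlt i j : (i < j)%N -> (j < N)%N -> x i != x j.
  move=> ij jN; apply/eqP => xij.
  have [_ hi] := hx i (ltn_trans ij jN); have [_ hj] := hx j jN.
  have := cn_trans (x j) (lam j) (lam i).
  rewrite -{2}xij (cnB (lam j) (x j)) (_ : lam j - lam i = w ^+ i * (w ^+ (j - i) - 1)); last first.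
    by rewrite mulrBr mulr1 -exprD subnKC ?(ltnW ij)// /lam; ring.
  rewrite cnM cnX w1 expr1n mul1r.
  have : 2 / M <= cn (w ^+ (j - i) - 1).
    apply: w_far; rewrite subn_gt0 ij /=.
    apply: leq_ltn_trans (leq_subr _ _) _; apply: leq_trans jN _.
    by rewrite -(ler_nat R) ltW.
  by move: hi hj; lra.
have urs : uniq rs.
  rewrite map_inj_in_uniq ?iota_uniq// => i j; rewrite !mem_iota => /andP[_ iN] /andP[_ jN] xij.
  apply/eqP; case: ltngtP => // ij; have := xlt _ _ ij; rewrite xij eqxx => h.
    by have := h jN.
  by have := h iN.
exists n, rho, (\prod_(z <- rs) ('X - z%:P)); split=> //.
- by rewrite /rho ltr_pdivrMr// mulrC -ltr_pdivrMr.
- have -> : n%:R * rho = 2 * Q by rewrite nM /rho; field; rewrite lt0r_neq0.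
  exact: lexx.
split.
- exact: monic_prod_XsubC.
- by rewrite size_prod_XsubC srs.
- move=> j jN; rewrite -{1 2}srs; apply: prod_XsubC_coef_bound => //; first exact: ltW.
  by rewrite srs ltnW.
- apply: uniq_roots_dvdp; last by rewrite uniq_rootsE.
  apply/allP => z /mapP [j]; rewrite mem_iota => /andP[_ jN] ->.
  by have [] := hx j jN.
Qed.

Definition hyp_rel c e h := exists2 n, (0 < n)%N &
  h = 'X * (1 + c *: 'X^e - (1 + 'X) ^+ n).

(** At s = B rho, the weighted norm of (1 + X)^n is at most (1 + s)^n <= exp (n s) <= exp (B K),
    uniformly in n since n rho <= K. The leading factor X then makes h small. *)
Lemma hyp_step c (e : nat) phi r eps del : (1 < e)%N ->
  0 < r -> 0 < eps -> 0 < del ->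
  (exists M, forall i, (M <= i)%N -> phi i = 0) ->
  exists h s psi, [/\ hyp_rel c e h, 0 < s, s <= r,
    exists M, forall i, (M <= i)%N -> psi i = 0 &
    [/\ forall i, cn (psi i - phi i) <= del * r ^+ i,
      mb s eps h & sbd s del (act h psi)]].
Proof.
move=> e1 r0 e0 d0 [M hM]; pose N := maxn M 1.
have N0 : (0 < N)%N by rewrite leq_max orbT.
have [K K0 hK] := hyp_roots c e1 N0.
pose C0 : R := 2 ^+ N; have C00 : 0 <= C0 by rewrite exprn_ge0.
pose B := 2 * (1 + C0); have B0 : 0 < B by rewrite mulr_gt0// ltr_pwDl.
apply: (@functional_step R (hyp_rel c e) N phi r eps del C0) => //.
  by move=> i iN; apply: hM; apply: leq_trans iN; rewrite leq_maxl.
move=> kap kap0.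
pose L := 1 + cn c + expR (B * K).
have L0 : 0 < L by rewrite addr_gt0 ?expR_gt0// ltr_pwDl// cn_ge0.
pose kap' := Num.min (Num.min kap B^-1) (eps / L / B).
have k'0 : 0 < kap' by rewrite !lt_min kap0 invr_gt0 B0 !divr_gt0.
have [n [rho [D [n0 rho0 rk nrho [Dm sD hD DP]]]]] := hK _ k'0.
move: rk; rewrite !lt_min -andbA => /and3P[rho_kap rhoB rhoL].
exists rho, ('X * (1 + c *: 'X^e - (1 + 'X) ^+ n)), D; split=> //; first by exists n.
split=> //; first by rewrite dvdp_mull.
rewrite -/B; set s := B * rho.
have s0 : 0 <= s by rewrite mulr_ge0 ?ltW.
have s1 : s <= 1 by rewrite /s mulrC -ler_pdivlMr// mul1r ltW.
have sL : s * L <= eps.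
  by rewrite -ler_pdivlMr// /s mulrC -ler_pdivlMr// ltW.
apply: (mb_le s0 sL); apply: (mbM (ltW L0) (mbX s0)).
apply: mbD.
  apply: mbD; first exact: mb1.
  apply: (@mb_le _ _ (cn c * s ^+ e)) => //; first by rewrite ler_piMr ?cn_ge0 ?exprn_ile1.
  by apply: mbZ; apply: mbXX => //; exact: mbX.
apply: mbN; apply: (@mb_le _ _ ((1 + s) ^+ n)) => //; last first.
  by apply: mbXX; [rewrite addr_ge0|apply: mbD; [exact: mb1|exact: mbX]].
apply: le_trans (_ : expR s ^+ n <= _).
  by rewrite lerXn2r ?nnegrE ?addr_ge0 ?expR_ge0// expR_ge1Dx.
rewrite -expRM_natr ler_expR /s -mulrA ler_pM2l// mulrC//.
Qed.

End HyperStep.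

(** * The sequence of relations *)

Section Iteration.
Variable R : realType.
Notation C := R[i].
Implicit Types (phi psi : nat -> C) (u v h : {poly C}) (s r e w : R) (k l : nat).
Implicit Types (H : {poly C} -> R -> Prop).

Definition toC (a : rat * rat) : C := (ratr a.1 +i* ratr a.2)%C.

(* [inl (s, l)]: some X * s - c X^N has norm at most 1 / (l + 1);
   [inr (a, e, l)]: the same for some X * (1 + a X^(e + 2) - (1 + X)^n). *)
Definition target := ((seq (rat * rat) * nat) + (rat * rat * nat * nat))%type.

Definition target_eps (t : target) : R :=
  match t with inl (_, l) => l.+1%:R^-1 | inr (_, _, l) => l.+1%:R^-1 end.

Definition target_rel (t : target) h : Prop :=
  match t with
  | inl (s, _) => sup_rel ('X * Poly (map toC s)) h
  | inr (a, e, _) => hyp_rel (toC a) e.+2 h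
  end.

Definition nth_target k : target := odflt (inl ([::], 0%N)) (unpickle k).

Lemma nth_target_surj t : exists k, nth_target k = t.
Proof. by exists (pickle t); rewrite /nth_target pickleK. Qed.

Lemma target_eps_gt0 t : 0 < target_eps t.
Proof. by case: t => [[? ?]|[[? ?] ?]] /=; rewrite invr_gt0. Qed.

Lemma target_step t phi r del : 0 < r -> 0 < del ->
  (exists M, forall i, (M <= i)%N -> phi i = 0) ->
  exists h s psi, [/\ target_rel t h, 0 < s, s <= r,
    exists M, forall i, (M <= i)%N -> psi i = 0 &
    [/\ forall i, cn (psi i - phi i) <= del * r ^+ i,
      mb s (target_eps t) h & sbd s del (act h psi)]].
Proof.
move=> r0 d0 hphi; have := target_eps_gt0 t.
case: t => [[q l]|[[a e] l]] /= e0; first exact: sup_step.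
exact: hyp_step.
Qed.

(** Divisibility by X makes the weighted norm of h at s tend to 0 with s, so that every relation
    holds at all small scales. *)
Lemma target_relX t h : target_rel t h -> exists v, h = 'X * v.
Proof.
case: t => [[q l]|[[a e] l]] /=; last by move=> [n _ ->]; eexists.
move=> [c [[|N] [// _ ->]]]; exists (Poly [seq toC i | i <- q] - c *: 'X^N).
by rewrite mulrBr -scalerAr -exprS.
Qed.

Lemma mon_mono H H' u w : (forall h e, H h e -> H' h e) -> mon H u w -> mon H' u w.
Proof.
move=> HH; elim=> [|u' w' _ IH|h e u' w' hh e0 _ IH]; first exact: mon1.
  exact: monX.
by apply: monH => //; exact: HH.
Qed.

(** Tests a perturbation of the functional on all products at once: at a scale where each relation
    holds, the weighted norm of a product is at most its weight. *)
Lemma mon_mb H s u w : 0 <= s -> s <= 1 ->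
  (forall h e, H h e -> mb s e h) -> mon H u w -> mb s w u.
Proof.
move=> s0 s1 hH; elim=> [|u' w' m IH|h e u' w' hh e0 m IH]; first exact: mb1.
  rewrite -[w']mul1r; apply: mbM => //; first exact: mon_ge0 m.
  exact: mb_le s1 (mbX s0).
by apply: mbM => //; [exact: mon_ge0 m|exact: hH].
Qed.

Lemma mb_ev s K w u psi : 0 <= K -> mb s w u -> sbd s K psi -> cn (ev psi u) <= K * w.
Proof.
by move=> K0 hu hp; have := hu K psi K0 hp 0%N; rewrite /act expr0 !mulr1.
Qed.

Definition add_rel H h0 e0 h e := H h e \/ h = h0 /\ e = e0.

(** Either the new relation does not occur in the product, or one occurrence can be moved to the
    front. *)
Lemma mon_add_rel H h0 e0 u w : mon (add_rel H h0 e0) u w ->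
  mon H u w \/ exists u' w', [/\ u = h0 * u', w = e0 * w' & mon (add_rel H h0 e0) u' w'].
Proof.
elim=> [|u' w' m [IH|[u2 [w2 [-> -> m2]]]]|h e u' w' [hh|[-> ->]] ep m IH].
- by left; exact: mon1.
- by left; exact: monX.
- by right; exists ('X * u2), w2; split; [rewrite mulrCA|by []|exact: monX].
- case: IH => [IH|[u2 [w2 [-> -> m2]]]]; first by left; exact: monH.
  right; exists (h * u2), (e * w2); split; [by rewrite mulrCA|by rewrite mulrCA|].
  by apply: monH => //; left.
- by right; exists u', w'; split.
Qed.

Notation state := ((nat -> C) * ({poly C} -> R -> Prop))%type.

Definition half k : R := 2^-1 ^+ k.

Lemma half_gt0 k : 0 < half k. Proof. by rewrite exprn_gt0// invr_gt0. Qed.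
Lemma halfS k : half k = half k.+1 + half k.+1.
Proof. by rewrite /half exprS; field. Qed.

(** The constant 2 - 2^-k increases with k: the increment pays for the change of the functional at
    each step. *)
Definition good k (st : state) : Prop :=
  [/\ exists M, forall i, (M <= i)%N -> st.1 i = 0,
    exists r, [/\ 0 < r, r <= 1 & forall h e, st.2 h e ->
      forall s, 0 < s -> s <= r -> mb s e h] &
    forall u w, mon st.2 u w -> cn (ev st.1 u) <= (2 - half k) * w].

Definition stepped k (st st' : state) : Prop :=
  [/\ exists2 h, target_rel (nth_target k) h & st'.2 h (target_eps (nth_target k)),
    forall h e, st.2 h e -> st'.2 h e &
    forall i, cn (st'.1 i - st.1 i) <= half k.+3].

(** Products of old relations change by at most [del] times their weight. On a product containing h,
    the new functional is at most [del <= e0] times the weight of the remaining factors. *)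
Lemma good_step k st : good k st -> exists st', good k.+1 st' /\ stepped k st st'.
Proof.
case: st => phi H [/= hM [r [r0 r1 hr]] hphi].
set t := nth_target k; pose e0 := target_eps t.
have e0p : 0 < e0 := target_eps_gt0 t.
pose del := Num.min (half k.+3) e0.
have d0 : 0 < del by rewrite lt_min half_gt0.
have [h [s [psi [th s0 sr hM' [h1 h2 h3]]]]] := target_step t r0 d0 hM.
exists (psi, add_rel H h e0); split; last first.
  split=> /=; first by exists h => //; right.
    by move=> h' e' hh; left.
  move=> i; apply: le_trans (h1 i) _; apply: le_trans (_ : half k.+3 * 1 <= _).
    apply: ler_pM; rewrite ?exprn_ge0 ?(ltW d0) ?(ltW r0) ?ge_min ?lexx//.
    by rewrite exprn_ile1// ltW.
  by rewrite mulr1.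
have [v hv] := target_relX th.
have s1 : s <= 1 by exact: le_trans r1.
have hs h' e' : add_rel H h e0 h' e' -> mb s e' h'.
  by move=> [/hr|[-> ->]]; [apply|].
split=> //=.
  have q0 : 0 < wt v + 1 by rewrite ltr_wpDl ?wt_ge0.
  (* With h = X v, the weighted norm of h at s' is at most s' (wt v + 1), hence at most [e0] below
     this radius. *)
  exists (Num.min r (e0 / (wt v + 1))); split.
  - by rewrite lt_min r0 divr_gt0.
  - by rewrite ge_min r1.
  move=> h' e' hh s' s'0; rewrite le_min => /andP[s'r s'e].
  case: hh => [/hr|[-> ->]]; first exact.
  have s'1 : s' <= 1 by exact: le_trans r1.
  rewrite hv; apply: (@mb_le _ _ (s' * wt v)) (ltW s'0) _ (mb_Xwt _ (ltW s'0) s'1).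
  apply: le_trans (_ : s' * (wt v + 1) <= _); first by rewrite ler_wpM2l ?(ltW s'0)// lerDl.
  by rewrite -ler_pdivlMr.
have hk1 : half k.+1 <= 1 by rewrite /half exprn_ile1// ?invr_ge0// invf_le1// ler1n.
have hk2 := halfS k; have hk3 := halfS k.+1; have hk4 := halfS k.+2.
have hkp := half_gt0 k.+3.
have dh : del <= half k.+3 by rewrite ge_min lexx.
have de : del <= e0 by rewrite ge_min lexx orbT.
move=> u w m; case: (mon_add_rel m) => [m'|[u' [w' [-> -> m']]]].
  have w0 := mon_ge0 m.
  have -> : ev psi u = ev phi u + ev (psi - phi) u by rewrite evDl evNl addrC subrK.
  apply: le_trans (cnD _ _) _.
  have b1 : cn (ev (psi - phi) u) <= del * w.
    apply: (@mb_ev r) => //; first exact: ltW.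
    by apply: (mon_mb (ltW r0) r1 _ m') => h' e' hh; exact: hr hh _ r0 (lexx _).
  apply: le_trans (lerD (hphi _ _ m') b1) _; rewrite -mulrDl ler_wpM2r//.
  lra.
rewrite -ev_act mulrA.
have w0 := mon_ge0 m'.
apply: le_trans (_ : del * w' <= _).
  by apply: (mb_ev (ltW d0) (mon_mb (ltW s0) s1 hs m') h3).
rewrite ler_wpM2r//; apply: le_trans de _; rewrite ler_peMl ?(ltW e0p)//; lra.
Qed.

Lemma exists_functional : exists H phi, [/\
  forall t, exists2 h, target_rel t h & H h (target_eps t),
  Psi H 2 phi & phi 1%N != 0].
Proof.
(* The coefficient of X, with no relation: the products are powers of X, and the bound is 2 - 2^0 =
   1. *)
pose st0 : state := ((fun i => (i == 1%N)%:R), fun _ _ => False).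
have g0 : good 0 st0.
  split=> /=; first by exists 2%N => i; case: i => [|[|i]].
    by exists 1; split.
  move=> u w m; have [i [-> ->]] : exists i, u = 'X^i /\ w = 1.
    elim: m => [|u' w' _ [i [-> ->]]|//]; first by exists 0%N; rewrite expr0.
    by exists i.+1; rewrite exprS.
  rewrite evXn cn_nat /half expr0 mulr1; case: (i == 1%N) => /=; lra.
pose T := {p : nat * state | good p.1 p.2}.
pose rel (x y : T) := (sval y).1 = (sval x).1.+1 /\ stepped (sval x).1 (sval x).2 (sval y).2.
have [x|f [f0 hf]] := @dependent_choice T rel _ (exist _ (0%N, st0) g0).
  case: x => [[k st] gk]; have [st' [g' hs]] := cid (good_step gk).
  by exists (exist _ (k.+1, st') g').
pose S k := (sval (f k)).2.
have fk k : (sval (f k)).1 = k.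
  by elim: k => [|k IH]; [rewrite f0|rewrite (hf k).1 IH].
have Sg k : good k (S k) by have := svalP (f k); rewrite fk.
have Ss k : stepped k (S k) (S k.+1) by have := (hf k).2; rewrite fk.
have S0 : S 0%N = st0 by rewrite /S f0.
have mono k l : (k <= l)%N -> forall h e, (S k).2 h e -> (S l).2 h e.
  elim: l => [|l IH]; first by rewrite leqn0 => /eqP ->.
  rewrite leq_eqVlt => /orP[/eqP ->//|]; rewrite ltnS => /IH h h' e' hh.
  by have [_ + _] := Ss l; apply; exact: h.
(* The steps half (j + 3) = half (j + 2) - half (j + 3) telescope. *)
have dist k l i : (k <= l)%N -> cn ((S l).1 i - (S k).1 i) <= half k.+2 - half l.+2.
  elim: l => [|l IH]; first by rewrite leqn0 => /eqP ->; rewrite !subrr cn0.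
  rewrite leq_eqVlt => /orP[/eqP ->|]; first by rewrite !subrr cn0.
  rewrite ltnS => /IH h; have [_ _ /(_ i) h'] := Ss l.
  apply: le_trans (cn_trans ((S l).1 i) _ _) _; have := halfS l.+2; move: h h'; lra.
have dist2 i k l : cn ((S k).1 i - (S l).1 i) <= half k.+2 + half l.+2.
  have := half_gt0 k.+2; have := half_gt0 l.+2.
  have [kl|lk] := leqP k l; first by rewrite cnB; have := dist k l i kl; lra.
  by have := dist l k i (ltnW lk); lra.
have /choice [phi hphi] : forall i, exists z : C, forall k, cn (z - (S k).1 i) <= half k.+2 *+ 2.
  by move=> i; exact: (complex_limit (dist2 i)).
(* A product involves finitely many relations, so it is already a product at some finite stage. *)
pose H h e := exists k, (S k).2 h e.
have Hmon u w : mon H u w -> exists k, mon (S k).2 u w.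
  elim=> [|u' w' _ [k m]|h e u' w' [k hh] e0 _ [l m]].
  - by exists 0%N; exact: mon1.
  - by exists k; exact: monX.
  exists (maxn k l); apply: monH => //; first exact: mono (leq_maxl _ _) _ _ hh.
  exact: mon_mono (mono _ _ (leq_maxr _ _)) m.
exists H, phi; split.
- move=> t; have [k <-] := nth_target_surj t; have [[h h1 h2] _ _] := Ss k.
  by exists h => //; exists k.+1.
- apply: (@Psi_lim _ _ (fun k => (S k).1) (fun k => half k.+2 *+ 2)) => //.
    move=> e e0; have [M hM] := exists_half_pow 1 e0; exists M => k Mk.
    rewrite mulr2n -halfS; apply: le_trans hM; rewrite mul1r.
    apply: ler_wiXn2l; rewrite ?invr_ge0// ?invf_le1 ?ler1n//.
    exact: leqW.
  move=> u w m; have [k m'] := Hmon u w m; exists k => l kl.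
  have [_ _ /(_ u w (mon_mono (mono _ _ kl) m'))] := Sg l => /le_trans; apply.
  by rewrite ler_wpM2r ?(mon_ge0 m)// gerBl ltW// half_gt0.
(* The total change of the value at X is at most 1 / 2, and its initial value is 1. *)
rewrite -cn_gt0; have := hphi 1%N 0%N; rewrite S0 /= cnB mulr2n -halfS.
have := cn_trans (phi 1%N) 1 0; rewrite !subr0 cn1 /half expr1; lra.
Qed.

End Iteration.

(** * Chaos and infinite dimension *)

Section Chaos.
Variable R : realType.
Notation C := R[i].
Variable H : {poly C} -> R -> Prop.
Variable phi : nat -> C.
Hypothesis H_target : forall t, exists2 h, target_rel t h & H h (target_eps R t).
Hypothesis phi_Psi : Psi H 2 phi.
Hypothesis phi1 : phi 1%N != 0.
Notation A := (alg H).
Notation P := (@alg_poly R H).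
Implicit Types (x y : A) (c z lam : C) (u v d : {poly C}) (e : R) (f : nat -> C).

Lemma toC_dense z e : 0 < e -> exists a, cn (z - toC R a) <= e.
Proof.
move=> e0; have e2 : 0 < e / 2 by rewrite divr_gt0.
have approx (x : R) : exists q, `|x - ratr q| <= e / 2.
  have [|q] := @rat_in_itvoo R (x - e / 2) (x + e / 2); first by lra.
  rewrite in_itv /= => /andP[h1 h2]; exists q; rewrite ler_norml; lra.
case: z => p q; have [a ha] := approx p; have [b hb] := approx q.
exists (a, b); apply: le_trans (cn_le_ReIm _) _.
by rewrite [e]splitr; apply: lerD.
Qed.

Lemma wtX u n b : (size u <= n)%N -> (forall i, (i < n)%N -> cn u`_i <= b) ->
  wt ('X * u) <= n%:R * b.
Proof.
move=> un hb; rewrite /wt.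
have le : (size ('X * u)%R <= n.+1)%N.
  by rewrite mulrC; apply: leq_trans (size_polyMleq _ _) _; rewrite size_polyX addn2.
rewrite (big_ord_widen n.+1 (fun i => cn ('X * u)`_i) le) big_mkcond.
apply: le_trans (_ : \sum_(i < n.+1) cn ('X * u)`_i <= _).
  by apply: ler_sum => i _; case: ifP => // _; exact: cn_ge0.
rewrite big_ord_recl coefXM /= cn0 add0r.
apply: le_trans (_ : \sum_(i < n) b <= _); last by rewrite sumr_const card_ord mulr_natl.
by apply: ler_sum => i _; rewrite coefXM /=; exact: hb i (ltn_ord i).
Qed.

Lemma rational_poly_dense u e : 0 < e ->
  exists s, nrm (P u - P (Poly (map (toC R) s))) <= e.
Proof.
move=> e0; pose n := (size u).+1; have n0 : (0 < n%:R :> R) by [].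
have /choice [a ha] : forall i, exists a, cn (u`_i - toC R a) <= e / n%:R.
  by move=> i; apply: toC_dense; rewrite divr_gt0.
exists (mkseq a n); rewrite -alg_polyB; apply: le_trans (nrm_poly_le _ _) _.
have -> : e = n%:R * (e / n%:R) by rewrite mulrC divfK ?gt_eqF//.
apply: wtX => [|i iN].
  apply: leq_trans (size_polyD _ _) _; rewrite size_polyN geq_max leqnSn andTb.
  by apply: leq_trans (size_Poly _) _; rewrite size_map size_mkseq.
by rewrite coefB coef_Poly (nth_map (0, 0)) ?size_mkseq// nth_mkseq.
Qed.

Lemma inv_nat_le e : 0 < e -> exists l, (l.+1%:R^-1 : R) <= e.
Proof.
move=> e0; have [l hl] := nat_gt e^-1; exists l.
rewrite -[leRHS]invrK lef_pV2 ?posrE ?invr_gt0//.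
by apply: ltW; apply: lt_le_trans hl _; rewrite ler_nat.
Qed.

(** x is close to a polynomial in the generator, then to one with rational coefficients, then to a
    multiple of a power by a relation of the first shape. *)
Lemma powers_dense x e : 0 < e -> exists c N, (1 < N)%N /\ nrm (x - c *: P 'X^N) <= e.
Proof.
move=> e0; have e3 : 0 < e / 3 by rewrite divr_gt0.
have [u hu] := alg_dense_poly x e3; have [s hs] := rational_poly_dense u e3.
have [l hl] := inv_nat_le e3.
have [h [c [[|N] [// N2 hE]]] hh] := H_target (inl (s, l)).
exists c, N; split=> //; set q := Poly _ in hs hE.
have hq : nrm (P (q - c *: 'X^N)) <= e / 3.
  apply: le_trans hl; apply: nrm_poly_H; last by rewrite invr_ge0.
  by rewrite mulrBr -scalerAr -exprS -hE.
move: hq; rewrite alg_polyB alg_polyZ => hq.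
apply: le_trans (nrm_trans (P u) _ _) _.
have := nrm_trans (P q) (P u) (c *: P 'X^N); move: hu hs hq; lra.
Qed.

(** Approximate x - X by c X^(N+1) with N >= 2, round c to a rational point, and apply a relation of
    the second shape. *)
Lemma orbit_dense x e : 0 < e -> exists2 n, (0 < n)%N & nrm (x - P ((1 + 'X) ^+ n)) <= e.
Proof.
move=> e0; have e3 : 0 < e / 3 by rewrite divr_gt0.
have [c [N [N1 hc]]] := powers_dense (x - P 1) e3.
have [a ha] := toC_dense c e3; have [l hl] := inv_nat_le e3.
case: N N1 hc => [|[|N]] // _ hc.
have [h [n n0 hE] hh] := H_target (inr (a, N, l)).
exists n => //.
have h1 : nrm (P (1 + toC R a *: 'X^(N.+2) - (1 + 'X) ^+ n)) <= e / 3.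
  by apply: le_trans hl; apply: nrm_poly_H; rewrite ?invr_ge0// -hE.
have h2 : nrm ((c - toC R a) *: P 'X^(N.+2)) <= e / 3.
  rewrite nrmZ; apply: le_trans ha; rewrite ler_piMr ?cn_ge0//.
  apply: nrm_le => //= t f t0 hf; rewrite opaE; last by exists t.
  by rewrite -exprS mul1r; exact: Psi_act_Xn.
rewrite alg_polyB alg_polyD alg_polyZ in h1; rewrite scalerBl in h2.
have -> : x - P ((1 + 'X) ^+ n) = (x - P 1 - c *: P 'X^(N.+2)) +
   ((c *: P 'X^(N.+2) - toC R a *: P 'X^(N.+2)) +
    (P 1 + toC R a *: P 'X^(N.+2) - P ((1 + 'X) ^+ n))).
  move: (P 1) (c *: _) (toC R a *: _) (P _) => p1 p q w.
  by rewrite [p1 + q]addrC -(addrA q) (addrA (p - q)) subrK (addrA _ p) subrK addrA subrK.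
apply: le_trans (nrmD _ _) _; apply: le_trans (lerD hc (nrmD _ _)) _.
by move: h1 h2; lra.
Qed.

(** Density of the orbit near z X, read on operators. *)
Lemma orbit_dense_op z e : 0 < e ->
  exists n, bnd H e (opa H ('X * (z%:P - (1 + 'X) ^+ n))).
Proof.
move=> e0; have [n _ hn] := orbit_dense (z *: P 1) e0; exists n.
apply: bnd_le hn _; rewrite -alg_polyZ -alg_polyB -mul_polyC mulr1.
exact: (bnd_nrm (P (z%:P - (1 + 'X) ^+ n))).
Qed.

Lemma phi_dual u : dualb H (act u phi).
Proof. by apply: dualb_act; exists 2. Qed.

Lemma act_1X_pow f n : act 'X f = 0 -> act ((1 + 'X) ^+ n) f = f.
Proof.
move=> h; elim: n => [|n IH].
  by rewrite expr0 act1.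
by rewrite exprSr -actM actDl h addr0 act1.
Qed.

(* On an eigenvector, X (1 + X)^n acts as lam (1 + lam)^n, and these numbers
   are not dense in the complex plane. *)
Lemma no_nonzero_eigenvalue lam f : dualb H f -> f != 0 ->
  act 'X f = (fun i => lam * f i) -> lam = 0.
Proof.
move=> [t t0 hf] f0 hX; apply/eqP; apply: contraT => lam0.
have actP u : act u f = fun i => u.[lam] * f i.
  elim/poly_ind: u => [|u c IH]; first by rewrite act0l; apply/funext => i; rewrite horner0 mul0r.
  rewrite actDl -actM hX actZ IH actC; apply/funext => i.
  by rewrite fctE hornerMXaddC; ring.
have [i fi0] : exists i, f i != 0.
  apply: contrapT => h; move/eqP: f0; apply; apply/funext => i.
  by apply/eqP; apply: contraT => fi; case: h; exists i.
have near z e : 0 < e -> exists n, cn lam * cn (z - (1 + lam) ^+ n) <= e.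
  move=> e0; have t1 : 0 < t + 1 by rewrite ltr_wpDl.
  have fip : 0 < cn (f i) by rewrite cn_gt0.
  have [n hn] := orbit_dense_op z (mulr_gt0 (divr_gt0 e0 t1) fip); exists n.
  have := hn t f t0 hf _ _ (monXn H i).
  rewrite opaE ?evXn ?actP; last by exists t.
  rewrite hornerM hornerX hornerD hornerN horner_exp hornerD hornerX !hornerC.
  rewrite !cnM mulr1 => h.
  rewrite -(ler_pM2r fip); apply: le_trans h _.
  rewrite mulrAC ler_wpM2r ?(ltW fip)// mulrAC ler_pdivrMr// ler_pM2l//; lra.
have lamp : 0 < cn lam by rewrite cn_gt0.
have e2 : 0 < cn lam / 2 by rewrite divr_gt0.
(* If |1 + lam| >= 1, the powers stay away from 0; otherwise they stay away from 2. *)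
have [h1|h1] := leP 1 (cn (1 + lam)).
  have [n] := near 0 _ e2; rewrite sub0r cnN cnX.
  have : 1 <= cn (1 + lam) ^+ n by exact: exprn_ege1.
  by move=> h2; rewrite ler_pM2l//; lra.
have [n] := near 2%:R _ e2; rewrite ler_pM2l// => h.
have h2 : cn (1 + lam) ^+ n <= 1 by rewrite exprn_ile1 ?cn_ge0 ?ltW.
have := cn_trans ((1 + lam) ^+ n) 2%:R 0; rewrite !subr0 cnX cn_nat; lra.
Qed.

(** Take an annihilator d of phi of least degree. Each root of d gives an eigenvector of X, so it is
    0. If d had degree 1, X would kill phi, contrary to phi(X) <> 0; in higher degree X^2 divides d,
    which yields f with g = X f nonzero and X g = 0. As (1 + X)^k fixes g, X (2 - (1 + X)^k) f = g
    for all k, yet some of these operators are arbitrarily small. *)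
Lemma poly_faithful u : act u phi = 0 -> u = 0.
Proof.
move=> hu; apply/eqP; apply: contraT => u0.
have hphi : phi != 0 by apply: contraNneq phi1 => ->.
pose Q n := `[< exists v, [/\ v != 0, act v phi = 0 & size v = n] >].
have exQ : exists n, Q n by exists (size u); apply/asboolP; exists u.
have [n /asboolP [d [d0 hd sd]] dmin] := ex_minnP exQ.
have small v : v != 0 -> (size v < n)%N -> act v phi != 0.
  move=> v0; apply: contraTneq => hv; rewrite -leqNgt; apply: dmin.
  by apply/asboolP; exists v.
have factor lam : root d lam -> exists v, [/\ v != 0, d = v * ('X - lam%:P),
    (size v < n)%N & lam = 0].
  move=> /factor_theorem [v dE]; have v0 : v != 0.
    by apply: contraNneq d0 => v0; rewrite dE v0 mul0r.
  have sv : (size v < n)%N by rewrite -sd dE size_Mmonic ?monicXsubC// size_XsubC addn2.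
  exists v; split=> //; apply: (no_nonzero_eigenvalue (phi_dual v) (small v v0 sv)).
  have := hd; rewrite dE mulrC -actM actDl -polyCN actC => h.
  apply/funext => i; have := congr1 (fun g => g i) h; rewrite !fctE mulNr.
  by move/eqP; rewrite subr_eq0 => /eqP.
have sd1 : size d != 1%N.
  apply/negP => /size_poly1P [c c0 dE]; move: hd; rewrite dE actC.
  move=> h; have /eqP : c * phi 1%N = 0 by exact: (congr1 (fun g => g 1%N) h).
  by rewrite mulf_eq0 (negPf c0) (negPf phi1).
have [lam rlam] := closed_rootP d sd1.
have [v [v0 dE sv lam0]] := factor _ rlam.
rewrite lam0 subr0 in dE.
have Xv : act 'X (act v phi) = 0 by rewrite actM mulrC -dE.
have [sv1|sv1] := eqVneq (size v) 1%N.
  have /size_poly1P [c c0 vE] : size v == 1%N by apply/eqP.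
  move: Xv; rewrite vE actC actZ => h.
  have /eqP : c * act 'X phi 0%N = 0 by exact: (congr1 (fun g => g 0%N) h).
  rewrite /act expr0 mulr1 -['X]expr1 evXn.
  by rewrite mulf_eq0 (negPf c0) (negPf phi1).
have [mu rmu] := closed_rootP v sv1.
have [_ [_ _ _ mu0]] : exists v, [/\ v != 0, d = v * ('X - mu%:P),
    (size v < n)%N & mu = 0] by apply: factor; rewrite dE rootM rmu.
move: rmu => /factor_theorem [v' vE]; rewrite mu0 subr0 in vE.
have gE : act 'X (act v' phi) = act v phi by rewrite actM mulrC -vE.
have /eqP [] := small v v0 sv.
have [t t0 ht] := phi_dual v'.
apply: (@Psi_eps0 _ H _ t) => // e e0.
have [k hk] := orbit_dense_op 2%:R e0; have := hk t _ t0 ht.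
rewrite opaE; last exact: phi_dual.
rewrite ['X * _]mulrC -actM gE actDl -scaleN1r actZl act_1X_pow//.
rewrite actC; congr Psi.
by apply/funext => i; rewrite !fctE; ring.
Qed.

(** A linear relation between powers of the generator, applied to phi, contradicts
    [poly_faithful]. *)
Lemma alg_infinite_dimensional : infinite_dimensional A.
Proof.
move=> n; exists (fun i => P 'X^i) => c h.
(* [insub] extends the family [c] from ['I_n] to [nat], with default value 0. *)
have Pu0 : P (\poly_(i < n) (if insub i is Some j then c j else 0)) = 0.
  rewrite -h poly_def (big_morph P (@alg_polyD _ H) (@alg_poly0 _ H)).
  by apply: eq_bigr => i _; rewrite alg_polyZ valK.
set u := \poly_(_ < _) _ in Pu0.
have : act ('X * u) phi = 0.
  have := congr1 (fun x : A => opval x phi) Pu0; rewrite /= opaE//.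
  by exists 2.
move=> /poly_faithful /eqP; rewrite mulf_eq0 polyX_eq0 /= => /eqP u0 i.
have := congr1 (fun p : {poly C} => p`_i) u0.
by rewrite coef_poly coef0 ltn_ord valK.
Qed.

Lemma alg_chaotic : chaotic_element (@alg_mul R H) (P 1).
Proof.
split; apply: dense_alg => x e e0.
  have [c [N [_ h]]] := powers_dense x e0; exists (c *: P 'X^N) => //.
  by exists c => //; exists N => //; rewrite alg_poly_pow.
have [n n0 h] := orbit_dense x e0; exists (P ((1 + 'X) ^+ n)) => //.
by exists n => //; rewrite alg_poly_orbit.
Qed.

End Chaos.

Unset Implicit Arguments.

Theorem theorem1p2 (R : realType) :
  exists (A : completeNormedModType R[i]) (mul : A -> A -> A),
    is_banach_algebra mul /\ infinite_dimensional A /\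
    exists a : A, chaotic_element mul a.
Proof.
have [H [phi [H_target phi_Psi phi1]]] := exists_functional R.
exists (alg H), (@alg_mul R H); split; first exact: alg_banach.
split; first exact: (alg_infinite_dimensional H_target phi_Psi phi1).
by exists (alg_poly H 1); exact: alg_chaotic.
Qed.
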